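(* Let $\psi:(0,\infty)\to(0,\infty)$ be a non-decreasing function such that $\sum_{k=1}^{\infty}\frac{1}{\psi(k)}=\infty$. Then for Lebesgue-almost every $\alpha\in\mathbb{R}$, the set \[\{N\in\mathbb{N}:\ \log P_N(\alpha)\le -\psi(\log N)\}\] has upper density $1$.
   Context: For $\alpha\in\mathbb{R}$ and $N\in\mathbb{N}$, the Sudler product is $P_N(\alpha):=\prod_{r=1}^{N}\lvert 2\sin(\pi r\alpha)\rvert$. The upper density of a set $A\subseteq\mathbb{N}$ is $\limsup_{M\to\infty}\frac{\#(A\cap\{1,\dots,M\})}{M}$. *)

(* Defs.v *)
From mathcomp Require Import all_boot all_order all_algebra.
From mathcomp Require Import all_classical all_reals all_analysis.
Set Implicit Arguments. Unset Strict Implicit. Unset Printing Implicit Defensive.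
Import Order.TTheory GRing.Theory Num.Theory.
Local Open Scope ring_scope.

Definition sudler (R : realType) (N : nat) (a : R) : R :=
  \prod_(1 <= r < N.+1) `| 2 * sin (pi * r%:R * a) |.

(* log P_N(a) <= -psi(log N), with the convention log 0 = -oo *)
Definition sudler_small (R : realType) (psi : R -> R) (a : R) (N : nat) : bool :=
  (1 < N)%N && ((sudler N a == 0) || (ln (sudler N a) <= - psi (ln N%:R))).

Definition density_seq (R : realType) (A : pred nat) (M : nat) : R :=
  (count A (iota 1 M))%:R / M%:R.

Definition upper_density (R : realType) (A : pred nat) : R :=
  limn_sup (density_seq R A).

(* Main.v *)
(* If [a] is extremely close to a reduced fraction [p / q], say
   [a = p / q + d] with [d = 1 / (q ^ 2 A)] and [A] large, then for
   [N <= q A / 16] the bound [|2 sin (y / 2)| ^ 2 <= |1 - r e^(iy)| ^ 2 / r] with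
   [r = 1 - 1 / (2 q)], followed by the Fourier expansion of [ln |1 - r e^(iy)|],
   splits [ln (sudler N a)] according to the frequency [m].  The multiples of [q]
   contribute at most [- N / (8 q)].  Among the other frequencies, those above [q]
   contribute [O(log q)], and those below [q] a trigonometric polynomial in [N]
   whose mean square over [N] is [O(log ^ 2 q)], provided that
   [\sum_(m < q) 1 / (m ^ 2 sin ^ 2 (pi m p / q)) = O(log ^ 2 q)].  So if
   [A >= T log q] with [T] large, then [ln (sudler N a) <= - c A] for all but a small
   proportion of the [N <= q A / 16].

   A positive proportion of the fractions [p / q] with [16 ^ (j - 1) < q <= 16 ^ j]
   in any given interval satisfies the above condition, by Dirichlet's theorem and a
   first moment estimate.  The sets of the [a] that are [1 / (q ^ 2 A_j)]-close to
   such a fraction, with [A_j = T max (psi (5 j), j)], are pairwise quasi-independent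
   with a divergent sum of measures, uniformly over all intervals; hence almost every
   [a] belongs to infinitely many of them by the Lebesgue density theorem.  The
   indices [j] with [A_j > T j ^ 2] are discarded, which keeps [log N] below [5 j]. *)

Require Import Defs.
From mathcomp Require Import all_boot all_order all_algebra.
From mathcomp Require Import all_classical all_reals all_analysis.
From mathcomp Require Import measurable_realfun.
From mathcomp Require Import ring lra zify.
Set Implicit Arguments. Unset Strict Implicit. Unset Printing Implicit Defensive.
Import Order.TTheory GRing.Theory Num.Theory.
Import numFieldNormedType.Exports.
Local Open Scope classical_set_scope.
Local Open Scope ring_scope.

(** The gain [N / (8 q)] has at most the order of [A], and [A] may be only a large multiple of
    [log q]. Bounding the frequencies below [q] one by one would cost about [log ^ 2 q]; the root
    mean square over [N] costs [O(log q)], and this is why an exceptional set of [N] appears.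

    The damping [1 - r = 1 / (2 q)] balances two demands: it costs [- ln r / 2], about [1 / (4 q)],
    in each factor, which the multiples of [q] must win back, while [r ^ q <= 2 / 3] makes the
    frequencies beyond [q] decay geometrically.

    The function [1 / sin ^ 2] is not integrable, so the first moment estimate is available only
    once the points with some [m x] within [1 / (64 m j)] of an integer are removed. This is also
    where the sum over dyadic scales comes from. *)

Local Notation mu := (@lebesgue_measure _).

(** * Trigonometric preliminaries *)

Lemma pi_le4 (R : realType) : (pi : R) <= 4.
Proof. by have /andP[_] := @pihalf_02 R; rewrite ltr_pdivrMr// => /ltW; lra. Qed.

Lemma ler_mul_cos_sin (R : realType) (y : R) : 0 <= y <= pi / 2 -> y * cos y <= sin y.
Proof.
case/andP=> y0 ypi.
pose f := fun x : R => sin x - x * cos x.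
have df (x : R) : is_derive x (1 : R) f (x * sin x).
  have -> : x * sin x = cos x - (x *: (- sin x) + cos x *: 1) :> R.
    by rewrite /GRing.scale/=; ring.
  exact: is_deriveB.
have cf : continuous f by move=> x; apply/differentiable_continuous/derivable1_diffP.
have [c] := @MVT_segment R f (fun x => x * sin x) 0 y y0 (fun x _ => df x)
  (continuous_subspaceT cf).
rewrite in_itv/= => /andP[c0 cy]; rewrite /f sin0 mul0r !subr0 => E.
rewrite -subr_ge0 E; apply: mulr_ge0 => //; apply: mulr_ge0 => //.
apply: sin_ge0_pi; rewrite c0/=; have := @pi_ge0 R; lra.
Qed.

(** Since [sin x = 2 sin (x / 2) cos (x / 2)], the preceding bound at [x / 2] gives
    [sin x >= x cos ^ 2 (x / 2)], and [cos x >= 0] forces [cos ^ 2 (x / 2) >= 1 / 2]. *)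
Lemma ler_half_sin (R : realType) (x : R) : 0 <= x <= pi / 2 -> x / 2 <= sin x.
Proof.
case/andP=> x0 xpi; have pi0 := @pi_ge0 R.
have y0 : 0 <= x / 2 <= pi / 2 by apply/andP; split; lra.
have := ler_mul_cos_sin y0; have c0 : 0 <= cos (x / 2) by apply: cos_ge0_pihalf; lra.
have : 0 <= cos x by apply: cos_ge0_pihalf; lra.
have xE : x = (x / 2) *+ 2 by rewrite -mulr_natr; field.
have -> : sin x = cos (x / 2) * sin (x / 2) * 2 by rewrite {1}xE sin_mulr2n mulr_natr.
have -> : cos x = cos (x / 2) ^+ 2 * 2 - 1 by rewrite {1}xE cos_mulr2n mulr_natr.
move: (cos _) (sin _) c0 => c s c0 h1 h2.
by have := ler_wpM2l c0 h2; nra.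
Qed.

Lemma sin_lip (R : realType) (x y : R) : `|sin x - sin y| <= `|x - y|.
Proof.
wlog xy : x y / y <= x.
  move=> H; have [/H//|/ltW/H] := leP y x; by rewrite distrC (distrC y).
have [c _ ->] := @MVT_segment R sin cos y x xy (fun z _ => is_derive_sin z)
  (continuous_subspaceT (@continuous_sin R)).
by rewrite normrM ler_piMl// cos_max.
Qed.

Lemma norm_sin_le (R : realType) (x : R) : `|sin x| <= `|x|.
Proof. by have := sin_lip x 0; rewrite sin0 !subr0. Qed.

Lemma cos_double (R : realType) (x : R) : cos (2 * x) = 1 - 2 * sin x ^+ 2.
Proof.
rewrite mulrC mulr_natr cos_mulr2n cos2sin2 -mulr_natr; ring.
Qed.

Lemma one_minus_cos_le (R : realType) (x : R) : 1 - cos x <= x ^+ 2 / 2.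
Proof.
have := cos_double (x / 2); have -> : 2 * (x / 2) = x by field.
have : sin (x / 2) ^+ 2 <= (x / 2) ^+ 2.
  by rewrite -[leLHS]real_normK ?num_real// -[leRHS]real_normK ?num_real// lerXn2r ?nnegrE ?norm_sin_le.
have -> : (x / 2) ^+ 2 = x ^+ 2 / 4 by field.
move=> h ->; move: (sin _ ^+ 2) (x ^+ 2) h => u w; lra.
Qed.

Lemma cosDint (R : realType) (x : R) (n : int) : cos (x + 2 * pi * n%:~R) = cos x.
Proof.
have H k (z : R) : cos (z + 2 * pi * k%:R) = cos z.
  have -> : 2 * pi * k%:R = pi *+ 2 *+ k :> R by rewrite -(mulr_natr (pi *+ 2)) -(mulr_natr pi) (mulrC 2).
  exact: (periodicn (@cosD2pi R)).
case: n => n; first by rewrite -pmulrn; exact: H.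
have <- : cos (x - 2 * pi * n.+1%:R + 2 * pi * n.+1%:R) = cos x by rewrite subrK.
by rewrite H NegzE mulrNz mulrN pmulrn.
Qed.

Lemma sinDint (R : realType) (x : R) (n : int) : `|sin (x + pi * n%:~R)| = `|sin x|.
Proof.
have H k (z : R) : `|sin (z + pi * k%:R)| = `|sin z|.
  rewrite mulr_natr.
  by rewrite (alternatingn (@sinDpi R)) normrM normrX normrN1 expr1n mul1r.
case: n => n; first by rewrite -pmulrn; exact: H.
have <- : `|sin (x - pi * n.+1%:R + pi * n.+1%:R)| = `|sin x| by rewrite subrK.
by rewrite H NegzE mulrNz mulrN pmulrn.
Qed.

(* [t] is a lower bound for the distance from [y] to the nearest integer *)
Lemma sin_ge_dist (R : realType) (y t : R) :
  (forall n : int, t <= `|y - n%:~R|) -> t <= `|sin (pi * y)|.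
Proof.
move=> H; pose n := Num.floor (y + 1 / 2).
have h1 : n%:~R <= y + 1 / 2 by apply: ge_floor.
have h2 : y + 1 / 2 < n%:~R + 1 by have := floorD1_gt (y + 1/2); rewrite intrD.
apply: (le_trans (H n)); set z := y - n%:~R.
have -> : `|sin (pi * y)| = `|sin (pi * `|z|)|.
  have -> : pi * y = pi * z + pi * n%:~R by rewrite /z; ring.
  rewrite sinDint; have [z0|z0] := leP 0 z; first by rewrite (ger0_norm z0).
  by rewrite (ltr0_norm z0) mulrN sinN [RHS]normrN.
have zh : `|z| <= 1 / 2 by rewrite ler_norml; apply/andP; split; rewrite /z; lra.
have pi2 := @pi_ge2 R; have z0 := normr_ge0 z.
have : `|z| * 2 <= pi * `|z| by nra.
have : pi * `|z| / 2 <= sin (pi * `|z|) by apply: ler_half_sin; apply/andP; split; nra.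
have := ler_norm (sin (pi * `|z|)); lra.
Qed.

(** * Fourier expansion of the logarithm *)

(* [|1 - s e^(it)| ^ 2] *)
Definition gker (R : realType) (s t : R) : R := 1 - 2 * s * cos t + s ^+ 2.

Lemma gker_ge (R : realType) (s t : R) : 0 <= s -> (1 - s) ^+ 2 <= gker s t.
Proof. by move=> s0; rewrite /gker; have := cos_le1 t; nra. Qed.

Lemma gker_gt0 (R : realType) (s t : R) : 0 <= s < 1 -> 0 < gker s t.
Proof.
by case/andP=> s0 s1; apply: lt_le_trans (gker_ge t s0); rewrite exprn_gt0// subr_gt0.
Qed.

(** Real part of the geometric sum of the [s ^ m e^(i (m + 1) t)], cleared of its denominator
    [|1 - s e^(it)| ^ 2]. *)
Lemma gker_sum (R : realType) (s t : R) (L : nat) :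
  gker s t * (\sum_(0 <= m < L) s ^+ m * cos (m.+1%:R * t)) =
  cos t - s - s ^+ L * cos (L.+1%:R * t) + s ^+ L.+1 * cos (L%:R * t).
Proof.
elim: L => [|L IH].
  by rewrite big_nil mulr0 mul0r cos0 expr0 expr1 !mul1r mulr1; ring.
rewrite big_nat_recr//= mulrDr IH /gker.
have -> : cos (L.+2%:R * t) = 2 * cos t * cos (L.+1%:R * t) - cos (L%:R * t).
  have -> : L.+2%:R * t = L.+1%:R * t + t by rewrite -[L.+2]addn1 natrD; ring.
  have -> : L%:R * t = L.+1%:R * t - t by rewrite -[L.+1]addn1 natrD; ring.
  by rewrite cosD cosB; ring.
by rewrite !exprS; ring.
Qed.

Lemma is_derive_expr (R : realType) (n : nat) (x : R) :
  is_derive x (1 : R) (fun s => s ^+ n.+1) ((n.+1%:R * x ^+ n) *: (1 : R)).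
Proof.
have -> : (fun s : R => s ^+ n.+1) = (@id R) ^+ n.+1.
  by apply/funext => s; elim: n => [|n IH]; rewrite ?expr1// exprS IH [in RHS]exprS.
exact: is_deriveX.
Qed.

Lemma is_derive_powsum (R : realType) (c : nat -> R) (L : nat) (x : R) :
  is_derive x (1 : R) (fun s => \sum_(0 <= m < L) s ^+ m.+1 * (c m / m.+1%:R))
    (\sum_(0 <= m < L) x ^+ m * c m).
Proof.
elim: L => [|L IH].
  rewrite big_nil (_ : (fun _ => _) = cst 0); first exact: is_derive_cst.
  by apply/funext => s; rewrite big_nil.
rewrite big_nat_recr//= (_ : (fun _ => _) =
   (fun s => \sum_(0 <= m < L) s ^+ m.+1 * (c m / m.+1%:R)) +
   (fun s => (c L / L.+1%:R) *: s ^+ L.+1)); last first.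
  by apply/funext => s; rewrite big_nat_recr//= (mulrC (s ^+ _) (c L / _)).
apply: is_deriveD.
have -> : x ^+ L * c L = (c L / L.+1%:R) *: ((L.+1%:R * x ^+ L) *: (1 : R)).
  by rewrite /GRing.scale/= mulr1; field; rewrite addrC natr1 pnatr_eq0.
apply: is_deriveZ.
exact: is_derive_expr.
Qed.

(* The derivative of the left-hand side is
   [(s ^+ L.+1 * cos (L t) - s ^+ L * cos (L.+1 t)) / gker s t]. *)
Lemma ln_gker_fourier (R : realType) (r t : R) (L : nat) : 0 < r < 1 ->
  `|ln (gker r t) / 2 + \sum_(0 <= m < L) r ^+ m.+1 * (cos (m.+1%:R * t) / m.+1%:R)|
  <= 2 * r ^+ L / (1 - r) ^+ 2.
Proof.
case/andP=> r0 r1.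
pose f (s : R) := ln (gker s t) / 2 +
  \sum_(0 <= m < L) s ^+ m.+1 * (cos (m.+1%:R * t) / m.+1%:R).
pose df (s : R) := (s - cos t) / gker s t +
  \sum_(0 <= m < L) s ^+ m * cos (m.+1%:R * t).
have isd (s : R) : 0 <= s < 1 -> is_derive s (1 : R) f (df s).
  move=> s01; apply: is_deriveD; last exact: is_derive_powsum.
  have g0 := gker_gt0 t s01.
  have -> : (s - cos t) / gker s t = 2^-1 *: ((gker s t)^-1 * (2 * (s - cos t))).
    by rewrite /GRing.scale/=; field; rewrite gt_eqF.
  rewrite (_ : (fun _ => _) = (fun s => 2^-1 *: ln (gker s t))); last first.
    by apply/funext => z; rewrite /GRing.scale/= mulrC.
  apply: is_deriveZ.
  apply: (@is_derive1_comp _ (@ln R) (fun s => gker s t) s); first exact: is_derive1_ln.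
  have -> : 2 * (s - cos t) = 0 - (2 * cos t) *: 1 + (2%:R * s ^+ 1) *: 1 :> R.
    by rewrite /GRing.scale/=; ring.
  rewrite (_ : (fun _ => _) = (cst 1 - (fun s => (2 * cos t) *: s) + (fun s => s ^+ 2))).
    by apply: is_deriveD; exact: is_derive_expr.
  by apply/funext => z; rewrite /gker /GRing.scale/= ; congr (_ - _ + _); ring.
have cf : {within `[0, r], continuous f}.
  apply: derivable_within_continuous => x; rewrite in_itv/= => /andP[x0 xr].
  by apply: ex_derive; apply: isd; rewrite x0 (le_lt_trans xr).
have [x|c + E] := @MVT_segment R f df 0 r (ltW r0) _ cf.
  by rewrite in_itv/= => /andP[x0 xr]; apply: isd; rewrite (ltW x0) (lt_trans xr).
rewrite in_itv/= => /andP[c0 cr].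
have f0 : f 0 = 0.
  rewrite /f big_nat big1; last by move=> i _; rewrite exprS !mul0r.
  by rewrite /gker mulr0 mul0r subr0 expr0n/= !addr0 ln1 mul0r.
rewrite -/(f r); have -> : f r = df c * r by rewrite -[LHS]subr0 -f0 E subr0.
have c01 : 0 <= c < 1 by rewrite c0 (le_lt_trans cr).
have g0 := gker_gt0 t c01; have g1 := gker_ge t c0.
have r1p : 0 < (1 - r) ^+ 2 by rewrite exprn_gt0// subr_gt0.
have g2 : (1 - r) ^+ 2 <= gker c t.
  by apply: le_trans g1; rewrite lerXn2r ?nnegrE; lra.
have -> : df c = (c ^+ L.+1 * cos (L%:R * t) - c ^+ L * cos (L.+1%:R * t)) / gker c t.
  apply: (mulIf (lt0r_neq0 g0)); rewrite divfK ?lt0r_neq0// mulrDl divfK ?lt0r_neq0//.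
  by rewrite [X in _ + X]mulrC gker_sum; ring.
have cL : c ^+ L <= r ^+ L by rewrite lerXn2r ?nnegrE// ltW.
have cL0 : 0 <= c ^+ L by rewrite exprn_ge0.
have n2 : `|c ^+ L.+1 * cos (L%:R * t) - c ^+ L * cos (L.+1%:R * t)| <= 2 * r ^+ L.
  apply: (le_trans (ler_normB _ _)); rewrite !normrM !(ger0_norm (exprn_ge0 _ _))//.
  have := cos_max (L%:R * t); have := normr_ge0 (cos (L%:R * t)); set w := `|_| => w0 w1.
  have := cos_max (L.+1%:R * t); have := normr_ge0 (cos (L.+1%:R * t)); set u := `|_| => u0 u1.
  rewrite exprS; set z := c ^+ L in cL cL0 *; case/andP: c01 => _ c1.
  have : c * z * w <= z by apply: (le_trans (ler_piMr _ w1)); [exact: mulr_ge0|exact: ler_piMl (ltW c1)].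
  have : z * u <= z by exact: ler_piMr.
  lra.
rewrite normrM (ger0_norm (ltW r0)) normrM normfV (gtr0_norm g0).
have h : 0 <= `|c ^+ L.+1 * cos (L%:R * t) - c ^+ L * cos (L.+1%:R * t)| / gker c t.
  by rewrite divr_ge0// ltW.
apply: le_trans (_ : _ <= `|c ^+ L.+1 * cos (L%:R * t) - c ^+ L * cos (L.+1%:R * t)| / gker c t) _.
  by rewrite ler_piMr// ltW.
by apply: ler_pM => //; [rewrite invr_ge0 ltW|rewrite lef_pV2 ?posrE].
Qed.

Definition csum (R : realType) (N : nat) (y : R) : R :=
  \sum_(1 <= r < N.+1) cos (2 * pi * r%:R * y).

(** Telescoping: [2 sin (pi y) cos (2 pi r y)] is the difference of [sin ((2 r + 1) pi y)] and
    [sin ((2 r - 1) pi y)]. *)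
Lemma csumE (R : realType) (N : nat) (y : R) :
  csum N y * (2 * sin (pi * y)) = sin ((2 * N%:R + 1) * pi * y) - sin (pi * y).
Proof.
rewrite /csum; elim: N => [|N IH].
  by rewrite big_nil mul0r mulr0 add0r mul1r subrr.
rewrite big_nat_recr//= mulrDl IH.
have -> : (2 * N.+1%:R + 1) * pi * y = 2 * pi * N.+1%:R * y + pi * y by ring.
have -> : (2 * N%:R + 1) * pi * y = 2 * pi * N.+1%:R * y - pi * y.
  by rewrite -natr1; ring.
by rewrite sinB sinD; ring.
Qed.

Lemma csum_le (R : realType) (N : nat) (y : R) : `|csum N y| * `|sin (pi * y)| <= 1.
Proof.
have E := csumE N y.
have : `|csum N y * (2 * sin (pi * y))| <= 2.
  rewrite E; apply: (le_trans (ler_normB _ _)).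
  have := sin_max ((2 * N%:R + 1) * pi * y); have := sin_max (pi * y); lra.
by rewrite !normrM (ger0_norm (ler0n _ 2)); lra.
Qed.

Lemma csumDint (R : realType) (N : nat) (y : R) (z : int) :
  csum N (y + z%:~R) = csum N y.
Proof.
apply: eq_bigr => r _.
have -> : 2 * pi * r%:R * (y + z%:~R) = 2 * pi * r%:R * y + 2 * pi * (r%:Z * z)%:~R.
  by rewrite intrM -pmulrn; ring.
by rewrite cosDint.
Qed.

Lemma sqr_two_sin_le_gker (R : realType) (r y : R) : 0 < r ->
  `|2 * sin (y / 2)| ^+ 2 <= gker r y / r.
Proof.
move=> r0; rewrite ler_pdivlMr// real_normK ?num_real// /gker.
have := cos_double (y / 2); have -> : 2 * (y / 2) = y by field.
move=> ->; rewrite exprMn -subr_ge0; move: (sin _ ^+ 2) => s.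
have -> : 1 - 2 * r * (1 - 2 * s) + r ^+ 2 - 2 ^+ 2 * s * r = (1 - r) ^+ 2 by ring.
exact: sqr_ge0.
Qed.

Lemma sudlerS (R : realType) (N : nat) (a : R) :
  sudler N.+1 a = sudler N a * `|2 * sin (pi * N.+1%:R * a)|.
Proof. by rewrite /sudler big_nat_recr. Qed.

(** The three terms are the price [- ln r / 2] of the damping in each factor, the first [L]
    frequencies summed over all factors, and the Fourier tail. A vanishing product is excluded
    because [ln] takes a conventional value at zero. *)
Lemma ln_sudler_le (R : realType) (N L : nat) (r a : R) : 0 < r < 1 ->
  sudler N a != 0 ->
  ln (sudler N a) <= - (N%:R * ln r / 2)
    - \sum_(0 <= m < L) r ^+ m.+1 / m.+1%:R * csum N (m.+1%:R * a)
    + N%:R * (2 * r ^+ L / (1 - r) ^+ 2).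
Proof.
move=> r01; have /andP[r0 r1] := r01.
elim: N => [_|N IH].
  rewrite /sudler big_nil ln1 !mul0r oppr0 add0r addr0 big1 ?oppr0// => m _.
  by rewrite /csum big_nil mulr0.
rewrite sudlerS mulf_eq0 negb_or => /andP[n0 s0].
have P0 : 0 < sudler N a.
  by rewrite lt_neqAle eq_sym n0; apply: prodr_ge0.
have S0 : 0 < `|2 * sin (pi * N.+1%:R * a)| by rewrite lt_neqAle eq_sym s0 normr_ge0.
rewrite lnM ?posrE//; have {}IH := IH n0.
set t := 2 * pi * N.+1%:R * a.
have -> : \sum_(0 <= m < L) r ^+ m.+1 / m.+1%:R * csum N.+1 (m.+1%:R * a) =
  \sum_(0 <= m < L) r ^+ m.+1 / m.+1%:R * csum N (m.+1%:R * a) +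
  \sum_(0 <= m < L) r ^+ m.+1 * (cos (m.+1%:R * t) / m.+1%:R).
  rewrite -big_split/=; apply: eq_bigr => m _.
  rewrite /csum big_nat_recr//= mulrDr; congr (_ + _).
  by rewrite -mulrA (mulrC (m.+1%:R^-1)); congr (_ * (cos _ / _)); rewrite /t; ring.
have := ln_gker_fourier t L r01; rewrite ler_norml => /andP[_].
have g0 : 0 < gker r t by apply: gker_gt0; rewrite ltW.
have key : ln `|2 * sin (pi * N.+1%:R * a)| <= (ln (gker r t) - ln r) / 2.
  rewrite ler_pdivlMr// (mulr_natr (ln _)) -lnXn// -lnV// -lnM ?posrE ?invr_gt0//.
  rewrite ler_ln ?posrE ?exprn_gt0 ?divr_gt0//.
  have -> : pi * N.+1%:R * a = t / 2 by rewrite /t; field.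
  exact: sqr_two_sin_le_gker.
move: key; set A := ln `|_|; rewrite -(natr1 N).
set S := \sum_(0 <= m < L) _ * csum _ _ in IH *; set e := 2 * r ^+ L / _ in IH *.
set S' := \sum_(0 <= m < L) _ => key key'; lra.
Qed.

Lemma ln_three_quarters (R : realType) : ln (3 / 4 : R) <= - (1 / 4).
Proof.
have := @le_ln1Dx R (- (1 / 4)); have -> : 1 + - (1 / 4) = 3 / 4 :> R by field.
by apply; lra.
Qed.

(** Such sums arise from the multiples of [q]. Reading [ln_gker_fourier] backwards turns them into
    the logarithms of [|1 - s e^(it)|] at [t = 2 pi n / X] for [n <= N]. From [pi <= 4] and
    [16 n <= X] follows [t <= 1 / 2], so [gker s t / s <= 1 / 2 + 1 / 4], where [1 / 2] bounds
    [(1 - s) ^ 2 / s]. Each factor thus gains [1 / 8]. *)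
Lemma csum_main_le (R : realType) (N K : nat) (s X : R) :
  1 / 2 <= s <= 2 / 3 -> 0 < X -> 16 * N%:R <= X ->
  - (N%:R * ln s / 2) - \sum_(0 <= k < K) s ^+ k.+1 / k.+1%:R * csum N (k.+1%:R / X)
  <= - (N%:R / 8) + N%:R * (18 * (2 / 3) ^+ K).
Proof.
case/andP=> s1 s2 X0.
have s01 : 0 < s < 1 by apply/andP; split; lra.
have /andP[s0 s1'] := s01.
elim: N => [_|N IH NX].
  rewrite !mul0r oppr0 add0r addr0 big1 ?oppr0// => m _.
  by rewrite /csum big_nil mulr0.
have N1 : N.+1%:R = N%:R + 1 :> R by rewrite natr1.
have {}IH := IH _; rewrite N1 in NX *; have {}IH := IH (ltac:(lra)).
set t := 2 * pi * N.+1%:R / X.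
have -> : \sum_(0 <= m < K) s ^+ m.+1 / m.+1%:R * csum N.+1 (m.+1%:R / X) =
  \sum_(0 <= m < K) s ^+ m.+1 / m.+1%:R * csum N (m.+1%:R / X) +
  \sum_(0 <= m < K) s ^+ m.+1 * (cos (m.+1%:R * t) / m.+1%:R).
  rewrite -big_split/=; apply: eq_bigr => m _.
  rewrite /csum big_nat_recr//= mulrDr; congr (_ + _).
  by rewrite -mulrA (mulrC (m.+1%:R^-1)); congr (_ * (cos _ / _)); rewrite /t; ring.
have := ln_gker_fourier t K s01; rewrite ler_norml => /andP[+ _].
have g0 : 0 < gker s t by apply: gker_gt0; rewrite ltW.
have key : (ln (gker s t) - ln s) / 2 <= - (1 / 8).
  suff : ln (gker s t) - ln s <= - (1 / 4) by lra.
  rewrite -lnV// -lnM ?posrE ?invr_gt0//; apply: le_trans (@ln_three_quarters R).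
  rewrite ler_ln ?posrE ?divr_gt0// ler_pdivrMr//.
  have t0 : 0 <= t by rewrite /t divr_ge0 ?mulr_ge0 ?pi_ge0// ltW.
  have th : t <= 1 / 2.
    rewrite /t ler_pdivrMr// N1.
    have := @pi_le4 R; have := @pi_ge0 R; have : 0 <= N%:R + 1 :> R by rewrite addr_ge0.
    nra.
  have := one_minus_cos_le t; have : t ^+ 2 <= 1 / 4 by rewrite expr2; nra.
  rewrite /gker; move: (cos t) (t ^+ 2) => c w hw hc.
  have : (1 - s) ^+ 2 <= s / 2 by rewrite expr2; nra.
  have -> : 1 - 2 * s * c + s ^+ 2 = (1 - s) ^+ 2 + 2 * s * (1 - c) by ring.
  nra.
have err : 2 * s ^+ K / (1 - s) ^+ 2 <= 18 * (2 / 3) ^+ K.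
  have p0 : 0 < (1 - s) ^+ 2 by rewrite exprn_gt0//; lra.
  rewrite ler_pdivrMr//.
  have h1 : s ^+ K <= (2 / 3) ^+ K by rewrite lerXn2r ?nnegrE//; lra.
  have h2 : 1 / 9 <= (1 - s) ^+ 2 by rewrite expr2; nra.
  have h3 : 0 <= (2 / 3 : R) ^+ K by rewrite exprn_ge0.
  have := ler_wpM2l h3 h2; lra.
move: IH err.
set S := \sum_(0 <= m < K) _ * csum _ _; set e := 2 * s ^+ K / _.
set S' := \sum_(0 <= m < K) _; lra.
Qed.

Lemma big_nat_blocks (R : nmodType) (F : nat -> R) (q K : nat) :
  \sum_(0 <= m < K * q) F m = \sum_(0 <= k < K) \sum_(0 <= s < q) F (k * q + s)%N.
Proof.
elim: K => [|K IH]; first by rewrite mul0n !big_nil.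
rewrite big_nat_recr//= -IH mulSn addnC (@big_cat_nat _ _ _ (K * q))//= ?leq_addr//.
congr (_ + _); rewrite -{1}[(K * q)%N]add0n big_addn addKn.
by apply: eq_bigr => s _; rewrite addnC.
Qed.

(* The frequencies [m < q] of [ln (sudler N a)], up to sign and to terms independent of [N]. *)
Definition wsum (R : realType) (r a : R) (q N : nat) : R :=
  \sum_(1 <= m < q) r ^+ m / (2 * m%:R * sin (pi * m%:R * a))
                   * sin ((2 * N%:R + 1) * pi * (m%:R * a)).

(** With [x = 1 / (2 q)], Bernoulli's inequality for [1 - x] gives the lower bound; for [1 + x] it
    gives [(1 + x) ^ q >= 3 / 2], which [(1 - x ^ 2) ^ q <= 1] turns into the upper bound. *)
Lemma rho_pow (R : realType) (q : nat) : (0 < q)%N ->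
  1 / 2 <= (1 - (2 * q%:R)^-1 : R) ^+ q <= 2 / 3.
Proof.
move=> q0; have q1 : 1 <= q%:R :> R by rewrite ler1n.
set x : R := (2 * q%:R)^-1.
have xq : x * q%:R = 1 / 2 by rewrite /x; field; lra.
have x0 : 0 < x by rewrite invr_gt0; lra.
have x1 : x <= 1 / 2 by nra.
have bern (y : R) n : -1 <= y -> 1 + y * n%:R <= (1 + y) ^+ n.
  move=> y1; elim: n => [|n IH]; first by rewrite mulr0 addr0.
  rewrite exprS -natr1; have h : 0 <= 1 + y by lra.
  have n0 : 0 <= n%:R :> R by [].
  have := ler_wpM2l h IH; have := mulr_ge0 n0 (sqr_ge0 y); rewrite expr2; nra.
apply/andP; split.
  have := bern (- x) q (ltac:(lra)); lra.
have h1 := bern x q (ltac:(lra)).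
have h2 : (1 - x) ^+ q * (1 + x) ^+ q <= 1.
  rewrite -exprMn exprn_ile1//; nra.
have h3 : 0 <= (1 - x) ^+ q by rewrite exprn_ge0//; lra.
nra.
Qed.

(** * Sudler products near a rational *)

Lemma sum_geom_two_thirds (R : realType) (K : nat) :
  \sum_(1 <= k < K) (2 / 3 : R) ^+ k <= 2.
Proof.
suff : \sum_(1 <= k < K) (2 / 3 : R) ^+ k <= 2 - 2 * (2 / 3) ^+ K.-1.
  have h : 0 <= (2 / 3 : R) ^+ K.-1 by apply: exprn_ge0; lra.
  lra.
case: K => [|K]; first by rewrite big_geq//= expr0; lra.
elim: K => [|K IH]; first by rewrite big_geq//= expr0; lra.
by rewrite big_nat_recr//=; move: IH; rewrite /= exprS; lra.
Qed.

Lemma sin_num_csum (R : realType) (N : nat) (y : R) : sin (pi * y) != 0 ->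
  csum N y = sin ((2 * N%:R + 1) * pi * y) / (2 * sin (pi * y)) - 1 / 2.
Proof.
move=> s0; have s2 : 2 * sin (pi * y) != 0 by rewrite mulf_neq0.
apply: (mulIf s2); rewrite csumE mulrBl divfK//; lra.
Qed.

(** Write a frequency as [k q + s]. At the multiples of [q] the point [m a] is a multiple of [1 / X]
    modulo one, so [csum_main_le] applies. The other frequencies cost [8 H] for [k >= 1], and leave
    [wsum] for [k = 0]. [H] plays the role of [log q]. *)
Lemma ln_sudler_near_rational (R : realType) (N q K : nat) (p : int) (a X H : R) :
  let u := fun s : nat => `|sin (pi * (s%:R * (p%:~R / q%:R)))| in
  (0 < q)%N -> (0 < K)%N -> 0 < X -> q%:R * a = p%:~R + X^-1 ->
  16 * N%:R <= X ->
  (forall s, (0 < s < q)%N -> 0 < u s) ->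
  (forall k s, (k < K)%N -> (0 < s < q)%N ->
     u s <= 2 * `|sin (pi * ((k * q + s)%:R * a))|) ->
  \sum_(1 <= s < q) (u s)^-1 <= 2 * q%:R * H ->
  \sum_(1 <= s < q) (s%:R)^-1 <= H ->
  sudler N a != 0 ->
  ln (sudler N a) <= - (N%:R / q%:R / 8) + N%:R * (8 * q%:R ^+ 2 * (2 / 3) ^+ K)
    + N%:R / q%:R * (18 * (2 / 3) ^+ K) + 9 * H
    + `|wsum (1 - (2 * q%:R)^-1) a q N|.
Proof.
move=> u q0 K0 X0 qa NX u0 uk sumu sums P0.
have qR : 0 < q%:R :> R by rewrite ltr0n.
have q1 : 1 <= q%:R :> R by rewrite ler1n.
set r : R := 1 - (2 * q%:R)^-1; set s := r ^+ q.
have xq : (2 * q%:R)^-1 * q%:R = 1 / 2 :> R by field; lra.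
have x0 : 0 < (2 * q%:R)^-1 :> R by rewrite invr_gt0; lra.
have r01 : 0 < r < 1 by rewrite /r; apply/andP; split; nra.
have /andP[r0 r1] := r01.
have sb : 1 / 2 <= s <= 2 / 3 by exact: rho_pow.
have /andP[s1 s2] := sb.
have := ln_sudler_le (K * q) r01 P0.
have lns : ln r = ln s / q%:R.
  by rewrite /s lnXn// -(mulr_natr (ln r)) mulfK// gt_eqF.
pose F m := r ^+ m / m%:R * csum N (m%:R * a).
have -> : \sum_(0 <= m < K * q) r ^+ m.+1 / m.+1%:R * csum N (m.+1%:R * a) =
  q%:R^-1 * (\sum_(0 <= k < K) s ^+ k.+1 / k.+1%:R * csum N (k.+1%:R / X)) +
  (\sum_(1 <= m < q) F m + \sum_(1 <= k < K) \sum_(1 <= m < q) F (k * q + m)%N).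
  transitivity (\sum_(0 <= m < K * q) F m.+1); first by [].
  have -> : \sum_(1 <= m < q) F m + \sum_(1 <= k < K) \sum_(1 <= m < q) F (k * q + m)%N
    = \sum_(0 <= k < K) \sum_(1 <= m < q) F (k * q + m)%N.
    by rewrite [RHS]big_ltn.
  (* Frequencies are numbered from one: block [k] runs over [k q + 1, ..., k q + q], and its
     multiple of [q] comes last. *)
  have split1 (G : nat -> R) : \sum_(0 <= m < q) G m = G q.-1 + \sum_(1 <= m < q) G m.-1.
    by case: (q) q0 => // q' _; rewrite big_nat_recr//= big_add1/= addrC.
  rewrite big_nat_blocks mulr_sumr -big_split/=; apply: eq_bigr => k _.
  rewrite split1; congr (_ + _); last first.
    by apply: eq_big_nat => i /andP[i0 _]; rewrite -addnS prednK.
  rewrite -addnS prednK// -mulSnr /F mulnC exprM -/s natrM.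
  have -> : q%:R * k.+1%:R * a = k.+1%:R / X + (k.+1%:Z * p)%:~R.
    by rewrite intrM -pmulrn mulrAC qa; ring.
  rewrite csumDint invfM; ring.
have main := csum_main_le K sb X0 NX.
set Sm := \sum_(0 <= k < K) s ^+ k.+1 / k.+1%:R * _ in main *.
set B := \sum_(1 <= k < K) _.
have FB k m : (k < K)%N -> (0 < m < q)%N ->
    `|csum N ((k * q + m)%:R * a)| <= 2 * (u m)^-1.
  move=> kK mq; have um := u0 _ mq; have := uk _ _ kK mq.
  have := csum_le N ((k * q + m)%:R * a).
  set c := `|csum _ _|; set v := `|sin _| => cv uv.
  have c0 : 0 <= c := normr_ge0 _; rewrite ler_pdivlMr//; nra.
(* The weight [r ^ (k q + m) / (k q + m)] is at most [(2 / 3) ^ k / q], so block [k] contributes at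
   most [(2 / 3) ^ k] times [4 H], and the geometric series is at most 2. *)
have HB : `|B| <= 8 * H.
  apply: (le_trans (ler_norm_sum _ _ _)).
  have step k : (1 <= k < K)%N ->
      `|\sum_(1 <= m < q) F (k * q + m)%N| <= (2 / 3) ^+ k * (4 * H).
    move=> /andP[k1 kK]; apply: (le_trans (ler_norm_sum _ _ _)).
    apply: le_trans (_ : \sum_(1 <= m < q) (2 / 3) ^+ k / q%:R * (2 * (u m)^-1) <= _).
      rewrite !big_nat; apply: ler_sum => m mq; rewrite /F normrM.
      apply: ler_pM => //; last exact: FB.
      rewrite ger0_norm ?divr_ge0 ?exprn_ge0 ?(ltW r0)//.
      apply: ler_pM; rewrite ?invr_ge0 ?exprn_ge0 ?(ltW r0)//.
        rewrite exprD mulnC exprM -/s.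
        have h1 : s ^+ k <= (2 / 3) ^+ k by rewrite lerXn2r ?nnegrE//; lra.
        have h2 : r ^+ m <= 1 by rewrite exprn_ile1// ltW.
        have h3 : 0 <= s ^+ k by rewrite exprn_ge0//; lra.
        have h4 : 0 <= r ^+ m by rewrite exprn_ge0// ltW.
        nra.
      rewrite lef_pV2 ?posrE ?ltr0n ?ler_nat ?addn_gt0 ?muln_gt0 ?q0 ?k1//.
      by rewrite (leq_trans _ (leq_addr _ _))// leq_pmull.
    rewrite -mulr_sumr -mulr_sumr -mulrA ler_wpM2l ?exprn_ge0//.
    rewrite mulrC ler_pdivrMr//; lra.
  rewrite big_nat; apply: (le_trans (ler_sum _ step)).
  rewrite -big_nat -mulr_suml.
  have H0 : 0 <= H by apply: le_trans sums; rewrite sumr_ge0// => i _; rewrite invr_ge0.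
  have := sum_geom_two_thirds R K; nra.
(* Only the sine part of the closed form of [csum] depends on [N]; the constants [- 1 / 2] cost at
   most [H / 2] altogether. *)
have W : - (\sum_(1 <= m < q) F m) <= `|wsum r a q N| + H / 2.
  have -> : \sum_(1 <= m < q) F m = wsum r a q N - \sum_(1 <= m < q) r ^+ m / m%:R / 2.
    rewrite /wsum -sumrB !big_nat; apply: eq_bigr => m mq.
    have := uk 0%N m K0 mq; rewrite mul0n add0n => um.
    have sm : sin (pi * (m%:R * a)) != 0.
      by rewrite -normr_gt0; have := u0 _ mq; lra.
    have m0 : m%:R != 0 :> R by case/andP: mq; case: (m) => // m'; rewrite pnatr_eq0.
    rewrite /F sin_num_csum// -(mulrA pi) -!(mulrA (2 * N%:R + 1)).
    by move: sm; set y := sin _ => sm; field; rewrite m0.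
  have : \sum_(1 <= m < q) r ^+ m / m%:R / 2 <= H / 2.
    rewrite -mulr_suml ler_wpM2r//; apply: le_trans sums; rewrite !big_nat.
    apply: ler_sum => m _; rewrite ler_piMl ?invr_ge0// exprn_ile1// ltW//.
  have := ler_norm (- wsum r a q N); rewrite normrN; lra.
have E : N%:R * (2 * r ^+ (K * q) / (1 - r) ^+ 2) <= N%:R * (8 * q%:R ^+ 2 * (2 / 3) ^+ K).
  apply: ler_wpM2l => //; rewrite mulnC exprM -/s.
  have -> : 2 * s ^+ K / (1 - r) ^+ 2 = 8 * q%:R ^+ 2 * s ^+ K.
    by rewrite /r; field; lra.
  apply: ler_wpM2l; first by rewrite mulr_ge0// exprn_ge0.
  rewrite lerXn2r ?nnegrE//; lra.
have H0 : 0 <= H by apply: le_trans sums; rewrite sumr_ge0// => i _; rewrite invr_ge0.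
have M : - (N%:R * ln r / 2) - q%:R^-1 * Sm <=
    - (N%:R / q%:R / 8) + N%:R / q%:R * (18 * (2 / 3) ^+ K).
  have qi : 0 <= q%:R^-1 :> R by rewrite invr_ge0.
  have := ler_wpM2l qi main; rewrite lns.
  set x := ln s; set y := (2 / 3) ^+ K; set z := q%:R^-1; lra.
have := ler_norm (- B); rewrite normrN.
move: HB W E M; set V := \sum_(1 <= m < q) F m; set e := N%:R * (2 * _ / _).
set x := `|B|; set e' := N%:R * (8 * _ * _); set y := N%:R / q%:R; set z := `|wsum _ _ _ _|.
set c := 18 * _; lra.
Qed.

(** Schur's test: expand the square, bound [c m * c m'] by half the sum of the two squares, and use
    the symmetry of the Gram matrix, so that only its row sums remain. *)
Lemma schur_test (R : realType) (I J : seq nat) (c : nat -> R) (f : nat -> nat -> R) (B : R) :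
  {in I, forall m, \sum_(m' <- I) `|\sum_(n <- J) f m n * f m' n| <= B} ->
  \sum_(n <- J) (\sum_(m <- I) c m * f m n) ^+ 2 <= B * \sum_(m <- I) c m ^+ 2.
Proof.
move=> HB; pose G m m' := `|\sum_(n <- J) f m n * f m' n|.
have Gs m m' : G m m' = G m' m.
  by rewrite /G; congr `|_|; apply: eq_bigr => n _; rewrite mulrC.
have -> : \sum_(n <- J) (\sum_(m <- I) c m * f m n) ^+ 2 =
    \sum_(m <- I) \sum_(m' <- I) c m * c m' * \sum_(n <- J) f m n * f m' n.
  under eq_bigr do rewrite expr2 mulr_suml.
  rewrite exchange_big/=; apply: eq_bigr => m _.
  under eq_bigr do rewrite mulr_sumr.
  rewrite exchange_big/=; apply: eq_bigr => m' _.
  by rewrite mulr_sumr; apply: eq_bigr => n _; ring.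
apply: le_trans (_ : \sum_(m <- I) \sum_(m' <- I) (c m ^+ 2 + c m' ^+ 2) / 2 * G m m' <= _).
  apply: ler_sum => m _; apply: ler_sum => m' _.
  apply: le_trans (ler_norm _) _; rewrite normrM; apply: ler_wpM2r => //.
  have := sqr_ge0 (c m - c m'); have := sqr_ge0 (c m + c m').
  by rewrite ler_norml !expr2 => h1 h2; apply/andP; split; lra.
have -> : \sum_(m <- I) \sum_(m' <- I) (c m ^+ 2 + c m' ^+ 2) / 2 * G m m' =
    \sum_(m <- I) c m ^+ 2 * \sum_(m' <- I) G m m'.
  transitivity (\sum_(m <- I) (c m ^+ 2 / 2 * \sum_(m' <- I) G m m') +
      \sum_(m <- I) (c m ^+ 2 / 2 * \sum_(m' <- I) G m m')); last first.
    by rewrite -big_split/=; apply: eq_bigr => m _; lra.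
  have {2}-> : \sum_(m <- I) (c m ^+ 2 / 2 * \sum_(m' <- I) G m m') =
      \sum_(m <- I) \sum_(m' <- I) c m' ^+ 2 / 2 * G m m'.
    rewrite exchange_big/=; apply: eq_bigr => m _; rewrite mulr_sumr.
    by apply: eq_bigr => m' _; rewrite Gs.
  rewrite -big_split/=; apply: eq_bigr => m _.
  rewrite mulr_sumr -big_split/=; apply: eq_bigr => m' _; lra.
rewrite mulr_sumr !(big_seq_cond xpredT); apply: ler_sum => m; rewrite andbT => mI.
by rewrite mulrC ler_wpM2r ?sqr_ge0// HB.
Qed.

(** Correlation kernel of the sines in [wsum]: the product of those at [m] and [m'], summed over
    [n], is half the difference of [oddcos] at [(m - m') a] and at [(m + m') a]. *)
Definition oddcos (R : realType) (M : nat) (y : R) : R :=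
  \sum_(1 <= n < M.+1) cos ((2 * n%:R + 1) * pi * y).

Lemma oddcos_le_num (R : realType) (M : nat) (y : R) : `|oddcos M y| <= M%:R.
Proof.
apply: (le_trans (ler_norm_sum _ _ _)); apply: le_trans (_ : \sum_(1 <= n < M.+1) 1 <= _).
  by apply: ler_sum => n _; exact: cos_max.
by rewrite sumr_const_nat subSS subn0.
Qed.

Lemma oddcos_le (R : realType) (M : nat) (y : R) :
  `|oddcos M y| * `|sin (pi * y)| <= 1.
Proof.
have E : oddcos M y * (2 * sin (pi * y)) =
    sin ((2 * M%:R + 2) * pi * y) - sin (2 * pi * y).
  rewrite /oddcos; elim: M => [|N IH].
    by rewrite big_nil mul0r mulr0 add0r subrr.
  rewrite big_nat_recr//= mulrDl IH.
  have -> : (2 * N.+1%:R + 2) * pi * y = (2 * N.+1%:R + 1) * pi * y + pi * y by ring.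
  have -> : (2 * N%:R + 2) * pi * y = (2 * N.+1%:R + 1) * pi * y - pi * y.
    by rewrite -natr1; ring.
  by rewrite sinB sinD; ring.
have : `|oddcos M y * (2 * sin (pi * y))| <= 2.
  rewrite E; apply: (le_trans (ler_normB _ _)).
  have := sin_max ((2 * M%:R + 2) * pi * y); have := sin_max (2 * pi * y); lra.
by rewrite !normrM (ger0_norm (ler0n _ 2)); lra.
Qed.

(** Almost orthogonality. Off the resonances [m' = m] and [m' = q - m] the correlations are
    controlled by [1 / u] at the residues of [m - m'] and [m + m'] modulo [q]. Along a row these
    stay distinct, so a row sum is at most [M] plus four times the sum of the [1 / u]. The range
    [s < 2 q] accommodates [m + m']. *)
Lemma wsum_sq_le (R : realType) (r a H : R) (q M : nat) (p : int) :
  let u := fun s : nat => `|sin (pi * (s%:R * (p%:~R / q%:R)))| in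
  0 < r < 1 -> (0 < q)%N ->
  (forall s, (0 < s < q)%N -> 0 < u s) ->
  (forall s, (0 < s < 2 * q)%N -> s != q ->
     u s <= 2 * `|sin (pi * (s%:R * a))|) ->
  \sum_(1 <= s < q) (u s)^-1 <= 2 * q%:R * H ->
  \sum_(1 <= n < M.+1) wsum r a q n ^+ 2 <=
    (M%:R + 8 * q%:R * H) * \sum_(1 <= m < q) (m%:R ^+ 2 * u m ^+ 2)^-1.
Proof.
move=> u r01 q0 u0 ua sumu.
have qR : q%:R != 0 :> R by rewrite pnatr_eq0 -lt0n.
have per n : u (q + n)%N = u n.
  rewrite /u; have -> : pi * ((q + n)%:R * (p%:~R / q%:R)) =
    pi * (n%:R * (p%:~R / q%:R)) + pi * p%:~R :> R by rewrite natrD; field.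
  exact: sinDint.
have uu n : 0 <= u n := normr_ge0 _.
pose v n := (u n)^-1; have v0 n : 0 <= v n by rewrite invr_ge0.
have sv0 b c : 0 <= \sum_(b <= s < c) v s by apply: sumr_ge0.
set S := \sum_(1 <= s < q) (u s)^-1 in sumu.
have partial b : (b <= q)%N -> \sum_(1 <= s < b) v s <= S.
  case: b => [|b] bq; first by rewrite big_geq//; exact: sv0.
  by rewrite /S (@big_cat_nat _ _ _ b.+1 1 q)//= lerDl; exact: sv0.
have D (n : nat) : (n < 2 * q)%N -> n != 0%N -> n != q ->
    `|oddcos M (n%:R * a)| <= 2 * v n.
  move=> n2 n0 nq; have := oddcos_le M (n%:R * a).
  have un : 0 < u n.
    have [nq'|qn] := ltnP n q; first by apply: u0; rewrite lt0n n0.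
    rewrite -(subnKC qn) per; apply: u0; rewrite subn_gt0 ltn_neqAle eq_sym nq qn/=.
    by rewrite ltn_subLR// addnn -mul2n.
  have := ua n; rewrite lt0n n0 n2 => /(_ isT nq).
  set c := `|oddcos _ _|; set w := `|sin _| => uw cw.
  have c0 : 0 <= c := normr_ge0 _; rewrite ler_pdivlMr//; nra.
pose f m n := sin ((2 * n%:R + 1) * pi * (m%:R * a)).
pose d m m' := (maxn m m' - minn m m')%N.
have ff m m' : \sum_(n <- index_iota 1 M.+1) f m n * f m' n =
    (oddcos M ((d m m')%:R * a) - oddcos M ((m + m')%:R * a)) / 2.
  rewrite /oddcos -sumrB mulr_suml; apply: eq_bigr => n _; rewrite /f.
  have -> : cos ((2 * n%:R + 1) * pi * ((d m m')%:R * a)) =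
            cos ((2 * n%:R + 1) * pi * (m%:R * a) - (2 * n%:R + 1) * pi * (m'%:R * a)).
    rewrite /d; have [mm|mm] := leqP m m'.
      rewrite natrB// -cosN; congr cos; ring.
    rewrite natrB ?(ltnW mm)//; congr cos; ring.
  have -> : (2 * n%:R + 1) * pi * ((m + m')%:R * a) =
     (2 * n%:R + 1) * pi * (m%:R * a) + (2 * n%:R + 1) * pi * (m'%:R * a).
    by rewrite natrD; ring.
  by rewrite cosB cosD; field.
have row : {in index_iota 1 q, forall m, \sum_(m' <- index_iota 1 q)
   `|\sum_(n <- index_iota 1 M.+1) f m n * f m' n| <= M%:R + 4 * S}.
  move=> m; rewrite mem_index_iota => /andP[m1 mq].
  (* [e1] bounds the term at [m - m'] and [e2] the one at [m + m']; at its resonant index each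
     admits only the trivial bound [M]. *)
  pose e1 m' := if m' == m then M%:R else 2 * v (d m m').
  pose e2 m' := if m' == (q - m)%N then M%:R else 2 * v (m + m')%N.
  apply: le_trans (_ : \sum_(1 <= m' < q) (e1 m' / 2 + e2 m' / 2) <= _).
    rewrite !big_nat; apply: ler_sum => m' /andP[m1' mq']; rewrite ff normrM.
    rewrite normfV (ger0_norm (ler0n _ 2)) -mulrDl ler_wpM2r//.
    apply: (le_trans (ler_normB _ _)); apply: lerD.
      rewrite /e1; case: eqP => [->|/eqP mm]; first exact: oddcos_le_num.
      by apply: D; rewrite /d; have [] := leqP m m'; lia.
    rewrite /e2; case: eqP => [->|/eqP mm]; first exact: oddcos_le_num.
    by apply: D; lia.
  rewrite big_split/= -!mulr_suml.
  have s1 : \sum_(1 <= m' < q) e1 m' <= M%:R + 4 * S.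
    rewrite (@big_cat_nat _ _ _ m)//=; last exact: ltnW.
    rewrite [X in _ + X](@big_ltn _ _ _ m)// {2}/e1 eqxx.
    have -> : \sum_(1 <= i < m) e1 i = 2 * \sum_(1 <= i < m) v i.
      rewrite mulr_sumr [RHS]big_nat_rev/= !big_nat; apply: eq_bigr => i /andP[i1 im].
      rewrite /e1 ltn_eqF//; congr (2 * v _); rewrite /d.
      by have [] := leqP m i; lia.
    have -> : \sum_(m.+1 <= i < q) e1 i = 2 * \sum_(1 <= i < q - m) v i.
      rewrite -{1}[m.+1]add1n big_addn mulr_sumr !big_nat; apply: eq_bigr => i /andP[i1 im].
      rewrite /e1 gtn_eqF ?ltn_add2r//; last by lia.
      by congr (2 * v _); rewrite /d; have [] := leqP m (i + m)%N; lia.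
    have := partial m (ltnW mq); have := partial (q - m)%N (leq_subr _ _); lra.
  have s2 : \sum_(1 <= m' < q) e2 m' <= M%:R + 4 * S.
    rewrite (@big_cat_nat _ _ _ (q - m)%N)//=; [|lia|lia].
    rewrite [X in _ + X](@big_ltn _ _ _ (q - m)%N)//; last by lia.
    rewrite {2}/e2 eqxx.
    have -> : \sum_(1 <= i < q - m) e2 i = 2 * \sum_(1 + m <= i < q) v i.
      rewrite big_addn mulr_sumr !big_nat; apply: eq_bigr => i /andP[i1 im].
      by rewrite /e2 ltn_eqF// addnC.
    have -> : \sum_((q - m).+1 <= i < q) e2 i = 2 * \sum_(1 <= i < m) v i.
      rewrite -{1}[(q - m).+1]add1n big_addn mulr_sumr subKn; last exact: ltnW.
      rewrite !big_nat; apply: eq_bigr => i /andP[i1 im].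
      rewrite /e2 gtn_eqF; last by lia.
      by rewrite /v -(per i); congr (2 * (u _)^-1); lia.
    have := partial m (ltnW mq).
    have : \sum_(1 + m <= i < q) v i <= S.
      by rewrite /S (@big_cat_nat _ _ _ (1 + m)%N 1 q)//= lerDr; exact: sv0.
    lra.
  lra.
pose c m := r ^+ m / (2 * m%:R * sin (pi * m%:R * a)).
apply: le_trans (schur_test c row) _.
have H0 : 0 <= \sum_(1 <= m < q) (m%:R ^+ 2 * u m ^+ 2)^-1.
  by apply: sumr_ge0 => m _; rewrite invr_ge0 mulr_ge0// ?sqr_ge0.
have S0 : 0 <= S := sv0 _ _.
apply: ler_pM => //; first by rewrite addr_ge0// mulr_ge0.
- by apply: sumr_ge0 => m _; exact: sqr_ge0.
- lra.
rewrite !big_nat; apply: ler_sum => m mq; rewrite /c.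
have := ua m; case/andP: (mq) => m0 mq'; rewrite m0 (ltn_eqF mq') => /(_ ltac:(lia) isT) um.
have um0 := u0 _ mq; case/andP: r01 => r0 r1.
have rm0 : 0 <= r ^+ m by rewrite exprn_ge0// ltW.
have rm1 : r ^+ m <= 1 by rewrite exprn_ile1// ltW.
have mR : 0 < m%:R :> R by rewrite ltr0n.
rewrite -[leLHS]real_normK ?num_real// normrM normfV !normrM (ger0_norm rm0).
rewrite (ger0_norm (ler0n _ 2)) (gtr0_norm mR) -(mulrA pi).
set w := `|sin _| in um *.
have w0 : 0 < w by lra.
have key : r ^+ m / (2 * m%:R * w) <= (m%:R * u m)^-1.
  rewrite ler_pdivrMr ?mulr_gt0//; apply: (le_trans rm1).
  by rewrite mulrC ler_pdivlMr ?mulr_gt0// mul1r; nra.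
rewrite -exprMn -exprVn lerXn2r// nnegrE.
  by rewrite divr_ge0// !mulr_ge0 ?(ltW w0) ?(ltW mR).
by rewrite invr_ge0 mulr_ge0 ?(ltW um0) ?(ltW mR).
Qed.

(* [p / q] is in lowest terms: it has no smaller denominator. *)
Definition primitive (p : int) (q : nat) : Prop :=
  forall (m : nat) (n : int), (0 < m < q)%N -> m%:Z * p != n * q%:Z.

Definition rsin (R : realType) (p : int) (q : nat) (s : nat) : R :=
  `|sin (pi * (s%:R * (p%:~R / q%:R)))|.

Lemma intr_dist_ge (R : realType) (z n : int) (q t : nat) : (0 < q)%N ->
  (t%:Z <= `|z - n * q%:Z|) -> t%:R / q%:R <= `|z%:~R / q%:R - n%:~R| :> R.
Proof.
move=> q0 zt; have qR : 0 < q%:R :> R by rewrite ltr0n.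
rewrite ler_pdivrMr// -[X in _ <= _ * X](gtr0_norm qR) -normrM mulrBl divfK ?gt_eqF//.
have -> : z%:~R - n%:~R * q%:R = (z - n * q%:Z)%:~R :> R by rewrite intrB intrM -pmulrn.
by rewrite -intr_norm pmulrn ler_int.
Qed.

Lemma rsin_ge (R : realType) (p : int) (q s t : nat) : (0 < q)%N ->
  (forall n : int, t%:Z <= `|s%:Z * p - n * q%:Z|) -> t%:R / q%:R <= rsin R p q s.
Proof.
move=> q0 H; apply: sin_ge_dist => n.
have -> : s%:R * (p%:~R / q%:R) = (s%:Z * p)%:~R / q%:R :> R by rewrite intrM mulrA.
exact: intr_dist_ge.
Qed.

Lemma rsin_ge1 (R : realType) (p : int) (q s : nat) : primitive p q ->
  (0 < s < q)%N -> q%:R^-1 <= rsin R p q s.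
Proof.
move=> pq sq; rewrite -[leLHS]mul1r; apply: (@rsin_ge R p q s 1); first by case/andP: sq; lia.
by move=> n; have := pq s n sq; lia.
Qed.

Lemma rsin_gt0 (R : realType) (p : int) (q s : nat) : primitive p q ->
  (0 < s < q)%N -> 0 < rsin R p q s.
Proof.
move=> pq sq; apply: lt_le_trans (rsin_ge1 R pq sq).
by rewrite invr_gt0 ltr0n; case/andP: sq; lia.
Qed.

(** By primitivity, [s -> s p mod q] permutes [1, ..., q - 1]. At residue [t] the cosecant is at
    most [q] over the smaller of [t] and [q - t]; [g] adds both possibilities. *)
Lemma sum_rsinV_le (R : realType) (p : int) (q : nat) : (0 < q)%N -> primitive p q ->
  \sum_(1 <= s < q) (rsin R p q s)^-1 <= 2 * q%:R * \sum_(1 <= s < q) s%:R^-1.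
Proof.
move=> q0 pq; pose r s := `|(s%:Z * p %% q%:Z)%Z|%N.
have q0' : q%:Z != 0 by lia.
have rE s : (r s)%:Z = (s%:Z * p %% q%:Z)%Z.
  by rewrite /r gez0_abs// modz_ge0.
have rq s : (r s < q)%N by have := ltz_pmod (s%:Z * p) (_ : 0 < q%:Z); rewrite -rE; lia.
have dE s : s%:Z * p = (s%:Z * p %/ q%:Z)%Z * q%:Z + (r s)%:Z by rewrite rE -divz_eq.
have r0 s : (0 < s < q)%N -> (0 < r s)%N.
  move=> sq; rewrite lt0n; apply/eqP => r0; have := dE s; rewrite r0 addr0 => E.
  by have := pq s (s%:Z * p %/ q%:Z)%Z sq; rewrite -E eqxx.
pose g t := q%:R * (t%:R^-1 + (q - t)%:R^-1) : R.
have step s : (0 < s < q)%N -> (rsin R p q s)^-1 <= g (r s).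
  move=> sq; have rs0 := r0 _ sq; have rqs := rq s.
  have qR : 0 < q%:R :> R by rewrite ltr0n.
  have half t : (0 < t)%N -> (t <= r s)%N -> (t <= q - r s)%N -> (rsin R p q s)^-1 <= q%:R * t%:R^-1.
    move=> t0 tr tq; have tR : 0 < t%:R :> R by rewrite ltr0n.
    rewrite -[q%:R * _]invrK invfM invrK mulrC lef_pV2 ?posrE ?divr_gt0 ?rsin_gt0//.
    apply: rsin_ge => // n; rewrite dE.
    set k := (_ %/ _)%Z; have [kn|kn] := leP n k.
      have : 0 <= (k - n) * q%:Z by apply: mulr_ge0; lia.
      by lia.
    have : 0 <= (n - k - 1) * q%:Z by apply: mulr_ge0; lia.
    by lia.
  have i0 t : 0 <= t%:R^-1 :> R by rewrite invr_ge0.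
  have [le|le] := leqP (r s) (q - r s).
    by apply: (le_trans (half (r s) _ _ _)) => //; rewrite /g ler_pM2l// lerDl.
  apply: (le_trans (half (q - r s)%N _ _ _)) => //; rewrite ?subn_gt0//.
    by rewrite ltnW.
  by rewrite /g ler_pM2l// lerDr.
apply: le_trans (_ : \sum_(1 <= s < q) g (r s) <= _).
  by rewrite !big_nat; apply: ler_sum => s; exact: step.
have inj : {in index_iota 1 q &, injective r}.
  have wl s s' : (0 < s < q)%N -> (s < s' < q)%N -> r s = r s' -> False.
    move=> sq ss' E; have := pq (s' - s)%N ((s'%:Z * p %/ q%:Z)%Z - (s%:Z * p %/ q%:Z)%Z).
    have -> : (s' - s)%N%:Z * p = s'%:Z * p - s%:Z * p.
      by rewrite -mulrBl subzn//; lia.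
    by rewrite {1}(dE s') {1}(dE s) E => /(_ ltac:(lia)) /eqP; apply; ring.
  move=> s s'; rewrite !mem_index_iota => sq sq' E.
  have [ss|ss|//] := ltngtP s s'.
    by case: (wl s s' sq _ E); lia.
  by case: (wl s' s sq' _ (esym E)); lia.
have perm : perm_eq (map r (index_iota 1 q)) (index_iota 1 q).
  have u1 : uniq (map r (index_iota 1 q)) by rewrite map_inj_in_uniq// iota_uniq.
  apply: uniq_perm => //; first exact: iota_uniq.
  have sub : {subset map r (index_iota 1 q) <= index_iota 1 q}.
    move=> t /mapP[s]; rewrite mem_index_iota => sq ->.
    by rewrite mem_index_iota r0//= rq.
  by case: (uniq_min_size u1 sub) => //; rewrite size_map.
have -> : \sum_(1 <= s < q) g (r s) = \sum_(1 <= s < q) g s.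
  by rewrite -(big_map r xpredT g); exact: perm_big.
rewrite -mulr_sumr big_split/= -mulrA mulrCA ler_wpM2l//.
have -> : \sum_(1 <= i < q) (q - i)%:R^-1 = \sum_(1 <= i < q) i%:R^-1 :> R.
  rewrite [RHS]big_nat_rev/= !big_nat; apply: eq_bigr => i _.
  by congr (_%:R^-1); lia.
lra.
Qed.

Lemma harmonic_le (R : realType) (q e : nat) : (q <= 2 ^ e)%N ->
  \sum_(1 <= s < q) s%:R^-1 <= e%:R :> R.
Proof.
move=> qe; apply: le_trans (_ : \sum_(1 <= s < 2 ^ e) s%:R^-1 <= _).
  case: q qe => [|q] qe; first by rewrite big_geq//; apply: sumr_ge0 => i _; rewrite invr_ge0.
  rewrite [leRHS](@big_cat_nat _ _ _ q.+1)//= lerDl.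
  by apply: sumr_ge0 => i _; rewrite invr_ge0.
elim: e {q qe} => [|e IH]; first by rewrite big_geq.
have e2 : (0 < 2 ^ e)%N by rewrite expn_gt0.
rewrite (@big_cat_nat _ _ _ (2 ^ e))//=; last by rewrite leq_exp2l.
rewrite -natr1; apply: lerD => //.
apply: le_trans (_ : \sum_(2 ^ e <= i < 2 ^ e.+1) (2 ^ e)%:R^-1 <= _).
  rewrite !big_nat; apply: ler_sum => i /andP[i1 _].
  by rewrite lef_pV2 ?posrE ?ltr0n ?ler_nat// (leq_trans e2).
rewrite sumr_const_nat expnS mul2n -addnn addnK -[leLHS]mulr_natr mulVf//.
Qed.

Lemma count_chebyshev (R : realType) (s : seq nat) (f : nat -> R) (t : R) : 0 < t ->
  (count (fun n => t < `|f n|) s)%:R * t ^+ 2 <= \sum_(n <- s) f n ^+ 2.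
Proof.
move=> t0; elim: s => [|n s IH]; first by rewrite big_nil mul0r.
rewrite big_cons /= natrD mulrDl; apply: lerD => //.
case: ltP => h; last by rewrite mul0r sqr_ge0.
by rewrite mul1r -[leRHS]real_normK ?num_real// lerXn2r ?nnegrE// ltW.
Qed.

Lemma count_lt_real (R : realType) (M : nat) (t : R) : 0 <= t ->
  (count (fun n => n%:R < t) (iota 1 M))%:R <= t.
Proof.
move=> t0; have /andP[t1 t2] := truncn_itv t0; apply: le_trans t1; rewrite ler_nat.
rewrite -size_filter -[leqRHS](size_iota 1); apply: uniq_leq_size.
  by rewrite filter_uniq// iota_uniq.
move=> n; rewrite mem_filter !mem_iota => /andP[nt /andP[n1 _]].
by rewrite n1 add1n -(ltr_nat R) (lt_trans nt).
Qed.

Lemma rsinD (R : realType) (p : int) (q k s : nat) : (0 < q)%N ->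
  rsin R p q (k * q + s) = rsin R p q s.
Proof.
move=> q0; have qR : q%:R != 0 :> R by rewrite pnatr_eq0 -lt0n.
rewrite /rsin -[RHS](sinDint _ (k%:Z * p)); congr (`|sin _|).
by rewrite natrD natrM intrM -pmulrn; field.
Qed.

Lemma two_thirds_pow (R : realType) (n : nat) :
  (2 / 3 : R) ^+ (2 * n) <= (1 / 2) ^+ n.
Proof. by rewrite exprM lerXn2r ?nnegrE ?exprn_ge0//; rewrite expr2; lra. Qed.

(** * Most [N] at a single well approximable point *)

Section NearRational.
Variables (R : realType) (eps T : R) (j q : nat) (p : int) (d : R).
Hypotheses (eps0 : 0 < eps) (eps1 : eps <= 1) (Teps : 2 ^+ 22 <= T * eps ^+ 2).
Hypotheses (j1 : (0 < j)%N) (jeps : (1 / 2) ^+ j * 2 ^+ 12 <= eps).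
Hypotheses (q0 : (0 < q)%N) (qj : (q <= 2 ^ (4 * j))%N) (pq : primitive p q).
Hypothesis good : \sum_(1 <= m < q) (m%:R ^+ 2 * rsin R p q m ^+ 2)^-1 <= 2 ^+ 18 * j%:R ^+ 2.
Variables (A a : R) (M K : nat).
Hypotheses (d0 : 0 < d) (Ad : q%:R ^+ 2 * d * A = 1) (AT : T * j%:R <= A).
Hypothesis aE : a = p%:~R / q%:R + d.
Hypotheses (K8 : K%:R <= A / 8 < K%:R + 1) (M16 : M%:R <= q%:R * A / 16 < M%:R + 1).
Let H : R := 4 * j%:R.

Let qR : 0 < q%:R :> R. Proof. by rewrite ltr0n. Qed.
Let qR1 : 1 <= q%:R :> R. Proof. by rewrite ler1n. Qed.
Let jR : 1 <= j%:R :> R. Proof. by rewrite ler1n. Qed.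
Let Teps1 : 2 ^+ 22 <= T * eps.
Proof.
have T0 : 0 <= T by have e2 : 0 < eps ^+ 2 by [rewrite exprn_gt0|]; rewrite -(pmulr_lge0 _ e2); apply: le_trans Teps; rewrite exprn_ge0.
by apply: le_trans Teps _; rewrite expr2 mulrA ler_piMr// mulr_ge0// ltW.
Qed.
Let T22 : 2 ^+ 22 <= T.
Proof.
have T0 : 0 <= T by rewrite -(pmulr_lge0 _ eps0); apply: le_trans Teps1; rewrite exprn_ge0.
by apply: le_trans Teps1 _; rewrite ler_piMr.
Qed.
Let Aj : 2 ^+ 22 * j%:R <= A.
Proof. by apply: le_trans AT; rewrite ler_wpM2r. Qed.
Let A0 : 0 < A. Proof. by have := Aj; have := jR; lra. Qed.
Let X0 : 0 < q%:R * A. Proof. exact: mulr_gt0. Qed.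
Let qa : q%:R * a = p%:~R + (q%:R * A)^-1.
Proof.
have -> : (q%:R * A)^-1 = q%:R * d.
  apply: (mulIf (lt0r_neq0 X0)); rewrite mulVf ?lt0r_neq0// -[LHS]Ad; ring.
by rewrite aE; field; rewrite gt_eqF.
Qed.
Let M32 : q%:R * A / 32 <= M%:R.
Proof.
have /andP[_] := M16; have : A <= q%:R * A by rewrite ler_pMl.
by have := Aj; have := jR; lra.
Qed.
Let K26 : (26 * j <= K)%N.
Proof.
rewrite -(ler_nat R) natrM; have /andP[_] := K8; have := Aj; have := jR; lra.
Qed.
(** For [n <= K q] the passage from [p / q] to [a] moves [n a] by at most [1 / (8 q)], hence the
    sine by at most [1 / (2 q)]. This is at most half of [rsin], which is at least [1 / q]. The size
    [A / 8] of [K] is chosen for this. *)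
Let low n s k : n = (k * q + s)%N -> (n <= K * q)%N -> (0 < s < q)%N ->
  rsin R p q s <= 2 * `|sin (pi * (n%:R * a))|.
Proof.
move=> nE nK sq; have h1 := rsin_ge1 R pq sq.
rewrite -(rsinD R p k s q0) -nE in h1 *.
have := sin_lip (pi * (n%:R * a)) (pi * (n%:R * (p%:~R / q%:R))).
have -> : pi * (n%:R * a) - pi * (n%:R * (p%:~R / q%:R)) = pi * (n%:R * d) by rewrite aE; ring.
have nd0 : 0 <= n%:R * d by rewrite mulr_ge0// ltW.
rewrite (ger0_norm (mulr_ge0 (pi_ge0 R) nd0)) => h2.
have h3 : n%:R * d <= (8 * q%:R)^-1.
  rewrite invfM -(ler_pM2r (_ : 0 < q%:R * A))//.
  have -> : 8^-1 / q%:R * (q%:R * A) = A / 8 by field; rewrite gt_eqF.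
  have : n%:R <= K%:R * q%:R :> R by rewrite -natrM ler_nat.
  move/(ler_wpM2r (ltW (mulr_gt0 d0 X0))); have /andP[k1 _] := K8.
  have -> : K%:R * q%:R * (d * (q%:R * A)) = K%:R * (q%:R ^+ 2 * d * A) by ring.
  by rewrite Ad mulr1 mulrA => h; exact: le_trans h k1.
have h4 : pi * (n%:R * d) <= q%:R^-1 / 2.
  have h5 := ler_wpM2l (pi_ge0 R) h3; apply: le_trans h5 _.
  rewrite invfM mulrA [leRHS]mulrC ler_pM2r ?invr_gt0//.
  by have := @pi_le4 R; lra.
have := lerB_dist (sin (pi * (n%:R * (p%:~R / q%:R)))) (sin (pi * (n%:R * a))).
by rewrite distrC -/(rsin R p q n) => h5; lra.
Qed.

Let sumv : \sum_(1 <= s < q) (rsin R p q s)^-1 <= 2 * q%:R * H.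
Proof.
apply: (le_trans (sum_rsinV_le R q0 pq)); apply: ler_wpM2l; first by rewrite mulr_ge0.
by have := @harmonic_le R q _ qj; rewrite natrM.
Qed.
Let sumh : \sum_(1 <= s < q) s%:R^-1 <= H.
Proof. by have := @harmonic_le R q _ qj; rewrite natrM. Qed.

Let K2 : (2 <= K)%N. Proof. by apply: leq_trans K26; rewrite mulnC (leq_trans _ (leq_pmull _ j1)). Qed.

Let W (n : nat) : R := wsum (1 - (2 * q%:R)^-1) a q n.
Let kap : R := eps / 2 ^+ 12.

Let sum_W : \sum_(1 <= n < M.+1) W n ^+ 2 <= (2 ^+ 20 * j%:R ^+ 2) * M%:R.
Proof.
have r01 : 0 < (1 - (2 * q%:R)^-1 : R) < 1.
  have : (2 * q%:R)^-1 <= 2^-1 :> R by rewrite lef_pV2 ?posrE ?mulr_gt0// ler_peMr.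
  have : 0 < (2 * q%:R)^-1 :> R by rewrite invr_gt0 mulr_gt0.
  by move=> h1 h2; apply/andP; split; lra.
have u0 s : (0 < s < q)%N -> 0 < rsin R p q s by exact: rsin_gt0.
have kq n : (n < 2 * q)%N -> (n <= K * q)%N.
  by move=> h; apply: leq_trans (ltnW h) _; rewrite leq_pmul2r.
have ua s : (0 < s < 2 * q)%N -> s != q -> rsin R p q s <= 2 * `|sin (pi * (s%:R * a))|.
  move=> /andP[s0 s2] sq; have [lt|ge] := ltnP s q.
    by apply: (@low s s 0%N) => //; [exact: kq|rewrite s0].
  have E : s = (1 * q + (s - q))%N by rewrite mul1n subnKC.
  rewrite {1}E rsinD//; apply: (@low _ _ 1%N) => //; first exact: kq.
  by rewrite subn_gt0 ltn_neqAle eq_sym sq ge/= ltn_subLR// addnn -mul2n.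
have h : \sum_(1 <= n < M.+1) W n ^+ 2 <= (M%:R + 8 * q%:R * H) *
    \sum_(1 <= m < q) (m%:R ^+ 2 * rsin R p q m ^+ 2)^-1.
  exact: (wsum_sq_le M r01 q0 u0 ua sumv).
apply: (le_trans h).
have g0 : 0 <= \sum_(1 <= m < q) (m%:R ^+ 2 * rsin R p q m ^+ 2)^-1.
  by apply: sumr_ge0 => m _; rewrite invr_ge0 mulr_ge0 ?sqr_ge0.
have h1 : 8 * q%:R * H <= M%:R.
  apply: le_trans M32; rewrite /H; have := ler_wpM2l (ltW qR) Aj.
  have : 0 <= q%:R * j%:R :> R by rewrite mulr_ge0.
  have -> : 8 * q%:R * (4 * j%:R) = 32 * (q%:R * j%:R) :> R by ring.
  rewrite (mulrCA q%:R (2 ^+ 22)); move: (q%:R * j%:R) (q%:R * A) => x y; lra.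
have M0 : 0 <= M%:R :> R by [].
apply: le_trans (_ : (2 * M%:R) * (2 ^+ 18 * j%:R ^+ 2) <= _).
  by apply: ler_pM => //; [rewrite addr_ge0// !mulr_ge0 /H//; lra|lra].
by have := mulr_ge0 M0 (sqr_ge0 (j%:R : R)); lra.
Qed.

(** Chebyshev's inequality with [sum_W]. Since [A >= T j], the claim reduces to
    [2 ^ 44 <= T ^ 2 eps ^ 3], which is the product of [T eps ^ 2 >= 2 ^ 22] and
    [T eps >= 2 ^ 22]. *)
Let count_W : (count (fun n => kap * A < `|W n|) (iota 1 M))%:R <= eps * M%:R.
Proof.
have kA0 : 0 < kap * A by rewrite mulr_gt0// divr_gt0// exprn_gt0.
have := count_chebyshev (iota 1 M) W kA0.
have := sum_W; rewrite /index_iota subSS subn0 => h1 /le_trans/(_ h1) h2.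
rewrite -(ler_pM2r (exprn_gt0 2 kA0)); apply: (le_trans h2).
rewrite (mulrAC eps); apply: ler_wpM2r => //.
have Tj0 : 0 <= T * j%:R by rewrite mulr_ge0//; have := T22; lra.
have AT2 : (T * j%:R) ^+ 2 <= A ^+ 2 by rewrite lerXn2r ?nnegrE ?(ltW A0).
rewrite /kap exprMn expr_div_n -exprM.
have e2 : 0 <= eps ^+ 3 / 2 ^+ (12 * 2) by rewrite divr_ge0 ?exprn_ge0// ltW.
have := ler_wpM2l e2 AT2; rewrite exprMn.
have -> : eps * (eps ^+ 2 / 2 ^+ (12 * 2) * A ^+ 2) = eps ^+ 3 / 2 ^+ (12 * 2) * A ^+ 2 by ring.
apply: le_trans; rewrite [leRHS]mulrA; apply: ler_wpM2r; first exact: sqr_ge0.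
have h3 : 2 ^+ 44 <= (T * eps ^+ 2) * (T * eps).
  rewrite (_ : 44 = 22 + 22)%N// exprD; apply: ler_pM => //; exact: exprn_ge0.
have -> : eps ^+ 3 / 2 ^+ (12 * 2) * T ^+ 2 = (T * eps ^+ 2) * (T * eps) / 2 ^+ (12 * 2).
  by ring.
rewrite ler_pdivlMr ?exprn_gt0//; apply: le_trans h3; rewrite -exprD; lra.
Qed.

Let le_count_M : 2 * j%:R / eps <= M%:R.
Proof.
apply: le_trans M32; rewrite ler_pdivrMr//.
have h1 : j%:R * 2 ^+ 22 <= A * eps.
  have := ler_wpM2r (ltW eps0) AT; apply: le_trans.
  by rewrite mulrAC mulrC ler_wpM2r.
have : A * eps <= q%:R * A * eps by rewrite -mulrA ler_peMl// mulr_ge0// ltW.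
by have := jR; lra.
Qed.

(** As [K >= 26 j], the power is at most [2 ^ (- 13 j)]. Of this, [2 ^ (- 12 j)] absorbs [q ^ 3],
    and the remaining [2 ^ (- j)] is small against [eps] by [jeps]. *)
Let small_pow : (q%:R ^+ 3) * (2 / 3) ^+ K * 2 ^+ 12 <= eps.
Proof.
have h1 : (2 / 3 : R) ^+ K <= (1 / 2) ^+ (13 * j).
  apply: le_trans (two_thirds_pow R (13 * j)); apply: ler_wiXn2l; [lra|lra|].
  by rewrite mulnA.
have h2 : q%:R ^+ 3 <= 2 ^+ (12 * j) :> R.
  rewrite -!natrX ler_nat (_ : 12 * j = 4 * j * 3)%N; last by rewrite mulnAC.
  by rewrite expnM leq_exp2r.
have h3 : 0 <= (2 / 3 : R) ^+ K by apply: exprn_ge0; lra.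
apply: le_trans jeps; apply: ler_wpM2r; first exact: exprn_ge0.
apply: le_trans (ler_pM _ h3 h2 h1) _; first by rewrite exprn_ge0.
have -> : (13 * j = 12 * j + j)%N by rewrite -mulSnr.
have -> : (1 / 2 : R) ^+ (12 * j + j) = (2 ^+ (12 * j))^-1 * (1 / 2) ^+ j.
  by rewrite exprD !div1r !exprVn.
by rewrite mulrA mulfV ?mul1r// expf_neq0.
Qed.

(** Here [N / q >= eps A / 32], so the main term is at most [- eps A / 2 ^ 8]. The term [9 H = 36 j]
    and the bound on [W] cost at most [eps A / 2 ^ 12] each, and the two tails together even less,
    which leaves more than [eps A / 2 ^ 10]. *)
Let ln_small N : (1 <= N <= M)%N -> eps * M%:R <= N%:R -> `|W N| <= kap * A ->
  sudler N a != 0 -> ln (sudler N a) <= - (eps / 2 ^+ 10 * A).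
Proof.
move=> /andP[N1 NM] epsN WN S0.
have NX : 16 * N%:R <= q%:R * A.
  have : N%:R <= M%:R :> R by rewrite ler_nat.
  by case/andP: M16; lra.
have uk k s : (k < K)%N -> (0 < s < q)%N ->
    rsin R p q s <= 2 * `|sin (pi * ((k * q + s)%:R * a))|.
  move=> kK sq; apply: (@low _ _ k) => //.
  apply: leq_trans (_ : k.+1 * q <= _)%N; last by rewrite leq_mul2r kK orbT.
  by rewrite mulSnr leq_add2l ltnW//; case/andP: sq.
have K0 : (0 < K)%N by exact: ltnW K2.
have := ln_sudler_near_rational q0 K0 X0 qa NX (fun s => rsin_gt0 R pq) uk sumv sumh S0.
rewrite -/(W N); move: WN small_pow; rewrite /kap /H.
set c := (2 / 3) ^+ K; set w := `|W N|; set l := ln _; set n := N%:R / q%:R.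
have c0 : 0 <= c by apply: exprn_ge0; lra.
have -> : N%:R * (8 * q%:R ^+ 2 * c) = n * 8 * (q%:R ^+ 3 * c).
  by rewrite /n; field; rewrite gt_eqF.
have n1 : eps * A / 32 <= n.
  rewrite /n ler_pdivlMr//; apply: le_trans epsN.
  by have := ler_wpM2l (ltW eps0) M32; lra.
have n2 : n <= A / 16 by rewrite /n ler_pdivrMr//; lra.
have n0 : 0 <= n by rewrite /n divr_ge0// ltW.
set z := q%:R ^+ 3 * c => hw hz.
have cz : c <= z by rewrite /z ler_peMl// exprn_ege1.
have h1 : 36 * j%:R <= A * (eps / 2 ^+ 12).
  have := ler_wpM2r (ltW eps0) AT; have := ler_wpM2r (ler0n R j) Teps1; have := jR.
  lra.
have h2 : n * z <= A / 16 * (eps / 2 ^+ 12).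
  apply: ler_pM => //; first by rewrite (le_trans c0).
  by rewrite ler_pdivlMr// exprn_gt0.
have h3 : n * c <= n * z by exact: ler_wpM2l.
have := mulr_gt0 A0 eps0; lra.
Qed.

(** Two kinds of [N] can fail, at most [eps M] of each: those below [eps M], where the main term is
    too weak, and those with a large [W]. The case [N = 1] is of the first kind because
    [2 j <= eps M]. The second conclusion makes [M] tend to infinity with [j]. *)
Lemma sudler_count_near_rational :
  (count (fun N => ~~ ((1 < N)%N && ((sudler N a == 0) ||
     (ln (sudler N a) <= - (eps / 2 ^+ 10 * A))))) (iota 1 M))%:R <= 2 * eps * M%:R
  /\ j%:R <= M%:R :> R.
Proof.
have jM : 2 * j%:R <= eps * M%:R by rewrite [leRHS]mulrC -ler_pdivrMr.
have M0 : 0 <= M%:R :> R by [].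
split; last by have := ler_wpM2r M0 eps1; have := jR; lra.
have e0 : 0 <= eps * M%:R by rewrite mulr_ge0// ltW.
apply: le_trans (_ : (count (fun n => n%:R < eps * M%:R) (iota 1 M) +
    count (fun n => (kap * A < `|W n|)%R) (iota 1 M))%:R <= _); last first.
  by rewrite natrD; have := count_lt_real M e0; have := count_W; lra.
rewrite ler_nat -count_predUI; apply: leq_trans (leq_addr _ _).
rewrite -!size_filter; apply: uniq_leq_size; first by rewrite filter_uniq// iota_uniq.
move=> N; rewrite !mem_filter mem_iota add1n ltnS => /andP[bad N1M]; rewrite N1M andbT.
apply: contraNT bad; rewrite /= negb_or -!leNgt => /andP[h1 h2].
have N2 : (1 < N)%N by rewrite -(ltr_nat R); have := jR; lra.
by rewrite N2; case: eqVneq => //= S0; exact: ln_small.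
Qed.

End NearRational.

(** * Lebesgue measure of finite unions and Markov's inequality *)

Lemma mu_itvcc (R : realType) (a b : R) : a <= b -> (mu `[a, b] = (b - a)%:E)%E.
Proof.
move=> ab; rewrite lebesgue_measure_itv/= lte_fin; case: ltP => // ba.
by rewrite (le_anti (introT andP (conj ab ba))) subrr.
Qed.

Lemma mu_itvco (R : realType) (a b : R) : a <= b -> (mu `[a, b[ = (b - a)%:E)%E.
Proof.
move=> ab; rewrite lebesgue_measure_itv/= lte_fin; case: ltP => // ba.
by rewrite (le_anti (introT andP (conj ab ba))) subrr.
Qed.

Lemma le_mu (R : realType) (A B : set R) : measurable A -> measurable B ->
  A `<=` B -> (mu A <= mu B)%E.
Proof. by move=> mA mB AB; apply: le_measure => //; rewrite inE. Qed.

Lemma measurable_bigU (R : realType) (I : eqType) (s : seq I) (F : I -> set R) :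
  {in s, forall i, measurable (F i)} -> measurable (\big[setU/set0]_(i <- s) F i).
Proof.
move=> mF; rewrite big_seq_cond; elim/big_ind : _ => //.
  exact: measurableU.
by move=> i; rewrite andbT => /mF.
Qed.

Lemma mu_bigU_le (R : realType) (I : eqType) (s : seq I) (F : I -> set R) (r : I -> R) :
  {in s, forall i, measurable (F i)} -> {in s, forall i, (mu (F i) <= (r i)%:E)%E} ->
  (mu (\big[setU/set0]_(i <- s) F i) <= (\sum_(i <- s) r i)%:E)%E.
Proof.
elim: s => [|i s IH] mF rF; first by rewrite !big_nil measure0.
have sub : {subset s <= i :: s} by move=> k; rewrite inE orbC => ->.
have mi : measurable (F i) by apply: mF; rewrite inE eqxx.
have ms : measurable (\big[setU/set0]_(i <- s) F i) by apply: measurable_bigU => k /sub/mF.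
rewrite !big_cons EFinD; have h := measureU2 (@lebesgue_measure R) mi ms; apply: (le_trans h); apply: leeD.
  by apply: rF; rewrite inE eqxx.
by apply: IH => k /sub; [exact: mF|exact: rF].
Qed.

Lemma in_bigU (T : Type) (I : eqType) (s : seq I) (F : I -> set T) (x : T) :
  (\big[setU/set0]_(i <- s) F i) x <-> exists2 i, i \in s & F i x.
Proof.
elim: s => [|j s IH]; first by rewrite big_nil; split => // -[].
rewrite big_cons; split=> [[Fj|/IH[i si Fi]]|[i]]; first by exists j; rewrite ?inE ?eqxx.
  by exists i; rewrite // inE si orbT.
by rewrite inE => /orP[/eqP->|si Fi]; [left|right; apply/IH; exists i].
Qed.

Lemma markov_indic (R : realType) (I : eqType) (s : seq I) (w r : I -> R)
    (S : I -> set R) (la : R) :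
  (forall i, 0 <= w i) -> (forall i, measurable (S i)) ->
  {in s, forall i, (mu (S i) <= (r i)%:E)%E} -> 0 < la ->
  let A := [set x | la <= \sum_(i <- s) w i * \1_(S i) x] in
  measurable A /\ (mu A <= ((\sum_(i <- s) w i * r i) / la)%:E)%E.
Proof.
move=> w0 mS rS la0 A; pose g (x : R) := \sum_(i <- s) w i * \1_(S i) x.
have mg : measurable_fun setT g.
  by apply: measurable_sum => i; apply: measurable_funM => //; exact: measurable_indic.
have mA : measurable A.
  have -> : A = setT `&` g @^-1` `[la, +oo[.
    by apply/seteqP; split => [x Ax|x [_]]; [split => //|]; rewrite /= in_itv/= andbT.
  by apply: mg => //.
split => //.
have h : (la%:E * mu A <= (\sum_(i <- s) w i * r i)%:E)%E.
  have -> : (mu A = \int[@lebesgue_measure R]_(x in setT) (\1_A x)%:E)%E.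
    by rewrite integral_indic// setIT.
  rewrite -ge0_integralZl_EFin//; last 2 first.
    by apply/measurable_EFinP; apply: measurable_indic; exact: mA.
    exact: ltW.
  apply: le_trans (_ : (\int[@lebesgue_measure R]_(x in setT) (g x)%:E <= _)%E).
    apply: ge0_le_integral => //.
    - by move=> x _; rewrite -EFinM lee_fin mulr_ge0// ltW.
    - by apply/measurable_EFinP; apply: measurable_funM => //; exact: measurable_indic.
    - exact/measurable_EFinP.
    - move=> x _; rewrite -EFinM lee_fin indicE; case: (boolP (x \in A)).
        by rewrite inE mulr1.
      by rewrite mulr0 => _; apply: sumr_ge0 => i _; rewrite mulr_ge0.
  under eq_integral do rewrite /g -sumEFin.
  rewrite ge0_integral_sum//; last 2 first.
    move=> i; apply/measurable_EFinP; apply: measurable_funM => //.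
    apply: measurable_indic. exact: mS.
    by move=> i x _; rewrite lee_fin; apply: mulr_ge0; [exact: w0|rewrite indicE].
  rewrite -sumEFin big_seq [leRHS]big_seq; apply: lee_sum => i si.
  under eq_integral do rewrite EFinM.
  rewrite ge0_integralZl_EFin//; last first.
    by apply/measurable_EFinP; apply: measurable_indic; exact: mS.
  rewrite integral_indic; [|exact: measurableT|exact: mS].
  rewrite setIT EFinM; apply: lee_wpmul2l; last exact: rS.
  by rewrite lee_fin.
rewrite -(@lee_pmul2l _ la%:E)//.
by apply: (le_trans h); rewrite -EFinM lee_fin mulrC divfK ?gt_eqF.
Qed.

(** * Approximation by good fractions *)

Definition nearint (R : realType) (m : nat) (t : R) : set R :=
  [set x | exists p : int, `|m%:R * x - p%:~R| <= t].

(** As [t <= 1], only integers between [m u - 1] and [m v + 1] matter; the 4 pays for the two ends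
    and the roundings. It reappears as the boundary term [4 / m] in [mu_nearint]. *)
Lemma nearint_cover (R : realType) (m : nat) (t u v : R) : (0 < m)%N -> t <= 1 -> u <= v ->
  let p0 := Num.floor (m%:R * u) - 1 in
  let n := (Num.truncn (m%:R * (v - u)) + 4)%N in
  `[u, v] `&` nearint m t `<=`
    \big[setU/set0]_(i <- iota 0 n) `[((p0 + i%:Z)%:~R - t) / m%:R, ((p0 + i%:Z)%:~R + t) / m%:R]%classic.
Proof.
move=> m0 t1 uv p0 n x [/=]; rewrite in_itv/= => /andP[ux xv] [p xp].
have mR : 0 < m%:R :> R by rewrite ltr0n.
have f1 : (Num.floor (m%:R * u))%:~R <= m%:R * u by apply: ge_floor.
have f2 : m%:R * u < (Num.floor (m%:R * u))%:~R + 1.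
  by have := floorD1_gt (m%:R * u); rewrite intrD.
have /andP[_ g2] : (Num.truncn (m%:R * (v - u)))%:R <= m%:R * (v - u) <
    (Num.truncn (m%:R * (v - u))).+1%:R.
  by apply: truncn_itv; rewrite mulr_ge0// subr_ge0.
move: (xp); rewrite ler_norml => /andP[h1 h2].
have mu1 : m%:R * u <= m%:R * x by rewrite ler_pM2l.
have mu2 : m%:R * x <= m%:R * v by rewrite ler_pM2l.
have p1 : p0 <= p.
  rewrite -(ler_int R) /p0 intrB; lra.
have p2 : p - p0 < n%:Z.
  have nE : (n%:Z)%:~R = (Num.truncn (m%:R * (v - u)))%:R + 4 :> R by rewrite -pmulrn natrD.
  rewrite -(ltr_int R) !intrB nE; move: g2; rewrite -natr1 mulrBr => g2; lra.
clear g2 f1 f2; clearbody p0 n.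
apply/in_bigU; exists `|p - p0|%N.
  by rewrite mem_iota leq0n add0n -ltz_nat gez0_abs ?subr_ge0.
have -> : p0 + `|p - p0|%N%:Z = p by rewrite gez0_abs ?subr_ge0// subrKC.
by rewrite /= in_itv/= ler_pdivrMr// ler_pdivlMr//; apply/andP; split; rewrite mulrC; lra.
Qed.

Lemma measurable_nearint (R : realType) (m : nat) (t : R) : measurable (nearint m t).
Proof.
have -> : nearint m t = \bigcup_(p in [set: int]) [set x | `|m%:R * x - p%:~R| <= t].
  by apply/seteqP; split => x [p]; [exists p|move=> _; exists p].
apply: countable_bigcupT_measurable => // p.
have mf : measurable_fun setT (fun x : R => `|m%:R * x - p%:~R|).
  apply: measurableT_comp => //; apply: measurable_funB => //.
have -> : [set x | `|m%:R * x - p%:~R| <= t] =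
    setT `&` (fun x : R => `|m%:R * x - p%:~R|) @^-1` `]-oo, t].
  by apply/seteqP; split => [x Ax|x [_]]; [split => //|]; rewrite /= in_itv/=.
exact: mf.
Qed.

Lemma mu_nearint (R : realType) (m : nat) (t u v : R) : (0 < m)%N -> 0 <= t <= 1 -> u <= v ->
  (mu (`[u, v] `&` nearint m t) <= ((v - u + 4 / m%:R) * (2 * t))%:E)%E.
Proof.
move=> m0 /andP[t0 t1] uv; have mR : 0 < m%:R :> R by rewrite ltr0n.
have sub := nearint_cover m0 t1 uv.
set p0 := Num.floor _ - 1 in sub; set n := (_ + 4)%N in sub.
have mF (i : nat) : measurable `[((p0 + i%:Z)%:~R - t) / m%:R, ((p0 + i%:Z)%:~R + t) / m%:R]%classic.
  exact: measurable_itv.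
apply: (le_trans (le_mu _ _ sub)).
- by apply: measurableI; [exact: measurable_itv|exact: measurable_nearint].
- by apply: measurable_bigU => i _; exact: mF.
apply: (le_trans (mu_bigU_le (r := fun=> 2 * t / m%:R) _ _)).
- by move=> i _; exact: mF.
- move=> i _; rewrite mu_itvcc; last by rewrite ler_pM2r ?invr_gt0//; lra.
  by rewrite lee_fin -mulrBl ler_pM2r ?invr_gt0//; lra.
have -> : \sum_(i <- iota 0 n) 2 * t / m%:R = n%:R * (2 * t / m%:R).
  by rewrite -{1}[n]subn0 -/(index_iota 0 n) sumr_const_nat subn0 -[LHS]mulr_natl.
rewrite lee_fin (_ : n%:R * (2 * t / m%:R) = n%:R / m%:R * (2 * t)); last by rewrite mulrA mulrAC.
apply: ler_wpM2r; first by rewrite mulr_ge0.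
rewrite ler_pdivrMr// mulrDl divfK ?gt_eqF// /n natrD lerD2r [leRHS]mulrC.
have : 0 <= m%:R * (v - u) by rewrite mulr_ge0// subr_ge0.
by case/truncn_itv/andP.
Qed.

Lemma nearint_mono (R : realType) (m : nat) (t t' : R) : t <= t' -> nearint m t `<=` nearint m t'.
Proof. by move=> tt x [p h]; exists p; exact: le_trans tt. Qed.

(** The pigeonhole principle provides some denominator; the least one is taken. If [m p = n q] with
    [m < q], then [|m x - n|] is [m / q] times [|q x - p|], which contradicts minimality. *)
Lemma dirichlet_primitive (R : realType) (x : R) (Q : nat) : (0 < Q)%N ->
  exists (q : nat) (p : int), [/\ (0 < q <= Q)%N, `|q%:R * x - p%:~R| <= Q%:R^-1
    & primitive p q].
Proof.
move=> Q0; have QR : 0 < Q%:R :> R by rewrite ltr0n.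
pose P (q : nat) := (0 < q)%N && `[< exists p : int, `|q%:R * x - p%:~R| <= Q%:R^-1 >].
pose fr (k : nat) := k%:R * x - (Num.floor (k%:R * x))%:~R.
have fr0 k : 0 <= fr k < 1.
  have := ge_floor (k%:R * x); have := floorD1_gt (k%:R * x); rewrite intrD /fr.
  by move=> h1 h2; apply/andP; split; lra.
have fQ k : (Num.truncn (Q%:R * fr k) < Q)%N.
  have /andP[h1 h2] := fr0 k; rewrite -(ltr_nat R).
  have : 0 <= Q%:R * fr k by rewrite mulr_ge0.
  case/truncn_itv/andP => h3 _; apply: (le_lt_trans h3).
  by rewrite gtr_pMr.
pose f (k : 'I_Q.+1) : 'I_Q := Ordinal (fQ k).
have wl (k k' : nat) : (k < k')%N -> (k' <= Q)%N ->
    Num.truncn (Q%:R * fr k) = Num.truncn (Q%:R * fr k') -> exists2 q, (q <= Q)%N & P q.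
  move=> kk kQ E; exists (k' - k)%N; first by rewrite (leq_trans (leq_subr _ _)).
  rewrite /P subn_gt0 kk; apply/asboolP.
  exists (Num.floor (k'%:R * x) - Num.floor (k%:R * x)).
  have -> : (k' - k)%:R * x - (Num.floor (k'%:R * x) - Num.floor (k%:R * x))%:~R = fr k' - fr k.
    by rewrite natrB ?(ltnW kk)// intrB /fr; ring.
  have pos z : 0 <= Q%:R * fr z by case/andP: (fr0 z) => *; rewrite mulr_ge0.
  have /andP[a1 a2] := truncn_itv (pos k); have /andP[b1 b2] := truncn_itv (pos k').
  rewrite -(ler_pM2l QR) mulfV ?gt_eqF// -{1}(gtr0_norm QR) -normrM mulrBr ler_norml.
  by rewrite E -natr1 in a1 a2 b1 b2 *; apply/andP; split; lra.
have exP : exists q, (q <= Q)%N && P q.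
  have /injectivePn[k [k' kk E]] : ~~ injectiveb f.
    by apply/negP => /injectiveP/leq_card; rewrite !card_ord ltnn.
  have {}E : Num.truncn (Q%:R * fr k) = Num.truncn (Q%:R * fr k') by case: E.
  have := ltn_ord k; have := ltn_ord k'; rewrite !ltnS => k'Q kQ.
  have [lt|lt|eq] := ltngtP k k'.
  - by have [q qQ Pq] := wl _ _ lt k'Q E; exists q; rewrite qQ.
  - by have [q qQ Pq] := wl _ _ lt kQ (esym E); exists q; rewrite qQ.
  - by move: kk; rewrite (val_inj eq) eqxx.
case: (ex_minnP exP) => q /andP[qQ /andP[q0 /asboolP[p qp]]] qmin.
exists q, p; split; rewrite ?q0// => m n /andP[m0 mq]; apply/eqP => E.
have qR : 0 < q%:R :> R by rewrite ltr0n.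
suff : (q <= m)%N by rewrite leqNgt mq.
apply: qmin; rewrite (leq_trans (ltnW mq) qQ)/= /P m0; apply/asboolP; exists n.
rewrite -(ler_pM2l qR) -{1}(gtr0_norm qR) -normrM.
have -> : q%:R * (m%:R * x - n%:~R) = m%:R * (q%:R * x - p%:~R).
  have := congr1 (fun z : int => z%:~R : R) E; rewrite /= !intrM -!pmulrn => E'.
  by rewrite !mulrBr E'; ring.
rewrite normrM (ger0_norm (ler0n _ m)); apply: ler_pM => //.
by rewrite ler_nat ltnW.
Qed.

(* The last condition controls the mean square of [wsum], see [wsum_sq_le]. *)
Definition good_frac (R : realType) (j : nat) : set R :=
  [set y | exists (q : nat) (p : int), [/\ (16 ^ j.-1 < q <= 16 ^ j)%N, primitive p q,
     y = p%:~R / q%:R &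
     \sum_(1 <= m < q) (m%:R ^+ 2 * rsin R p q m ^+ 2)^-1 <= 2 ^+ 18 * j%:R ^+ 2 ]].

(* The scales [2 ^- i] with [i < dyad m j] go from [1] down to about [1 / (64 m j)]. *)
Definition dyad (m j : nat) : nat := (trunc_log 2 (64 * m * j)).+1.

(** Take the least [i] such that [m x] is farther than [2 ^ (- i)] from the integers. The single
    term [i - 1] already suffices: its indicator is one, and [rsin >= 2 ^ (- i) / 2] gives an
    inverse square of at most [4 ^ (i + 1) = 16 * 4 ^ (i - 1)]. The hypothesis at scale
    [1 / (64 m j)] keeps [i - 1] in the range of the sum. *)
Lemma dyad_sum (R : realType) (j m q : nat) (p : int) (x : R) :
  (0 < j)%N -> (0 < m < q)%N -> primitive p q ->
  `|q%:R * x - p%:~R| <= q%:R^-1 ->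
  ~ nearint m ((64 * m * j)%:R^-1) x ->
  (m%:R ^+ 2 * rsin R p q m ^+ 2)^-1 <=
    16 * \sum_(i <- iota 0 (dyad m j)) 4 ^+ i / m%:R ^+ 2 * \1_(nearint m (2 ^- i)) x.
Proof.
move=> j0 mq pq qx far; have /andP[m0 mq'] := mq.
have mR : 0 < m%:R :> R by rewrite ltr0n.
have qR : 0 < q%:R :> R by rewrite ltr0n; lia.
have two0 n : 0 < 2 ^+ n :> R by rewrite exprn_gt0.
pose P i := `[< ~ nearint m (2 ^- i) x >].
have exP : exists i, P i.
  exists (dyad m j); apply/asboolP => h; apply: far; move: h; apply: nearint_mono.
  rewrite lef_pV2 ?posrE ?ltr0n ?muln_gt0 ?m0 ?j0// -natrX ler_nat ltnW//.
  exact: trunc_log_ltn.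
case: (ex_minnP exP) => i /asboolP Pi imin.
have i0 : (0 < i)%N.
  rewrite lt0n; apply/eqP => i0; apply: Pi; rewrite i0 expr0 invr1.
  exists (Num.floor (m%:R * x)); have := ge_floor (m%:R * x).
  by have := floorD1_gt (m%:R * x); rewrite intrD ler_norml => *; apply/andP; split; lra.
have iD : (i.-1 < dyad m j)%N.
  rewrite prednK//; apply: imin; apply/asboolP => h; apply: far; move: h; apply: nearint_mono.
  rewrite lef_pV2 ?posrE ?ltr0n ?muln_gt0 ?m0 ?j0// -natrX ler_nat ltnW//.
  exact: trunc_log_ltn.
have near : nearint m (2 ^- i.-1) x.
  apply: contrapT => h; have : P i.-1 by apply/asboolP.
  by move/imin; lia.
(* By primitivity [m p / q] is at least [1 / q] away from the integers, and [m x] is within [1 / q]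
   of it. So [m x] is at most twice as far from the integers as [m p / q]. *)
have low : 2 ^- i / 2 <= rsin R p q m.
  apply: sin_ge_dist => n; rewrite leNgt; apply/negP => h; apply: Pi; exists n.
  have h1 : q%:R^-1 <= `|m%:R * (p%:~R / q%:R) - n%:~R| :> R.
    have ge1 : 1%N%:Z <= `|m%:Z * p - n * q%:Z| by have := pq m n mq; lia.
    have q0 : (0 < q)%N by lia.
    by have := intr_dist_ge R q0 ge1; rewrite intrM -pmulrn -mulrA mul1r.
  have h2 : `|m%:R * x - m%:R * (p%:~R / q%:R)| <= q%:R^-1 :> R.
    have -> : m%:R * x - m%:R * (p%:~R / q%:R) = m%:R / q%:R * (q%:R * x - p%:~R).
      by field; rewrite gt_eqF.
    rewrite normrM ger0_norm ?divr_ge0//; apply: (le_trans _ qx).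
    by rewrite ler_piMl// ler_pdivrMr// mul1r ler_nat ltnW.
  have := ler_distD (m%:R * (p%:~R / q%:R)) (m%:R * x) n%:~R; lra.
have r0 : 0 < rsin R p q m by exact: rsin_gt0.
have low2 : 4 ^- i / 4 <= rsin R p q m ^+ 2.
  have -> : 4 ^- i / 4 = (2 ^- i / 2) ^+ 2 :> R.
    by rewrite exprMn -exprVn -exprVn -exprM mulnC exprM expr2; congr (_ ^+ _ * _); field.
  by rewrite lerXn2r ?nnegrE ?(ltW r0)// divr_ge0// invr_ge0 exprn_ge0.
apply: le_trans (_ : 16 * (4 ^+ i.-1 / m%:R ^+ 2) <= _); last first.
  rewrite ler_pM2l// (bigD1_seq i.-1) ?iota_uniq ?mem_iota//=.
  rewrite indicE (mem_set near) mulr1 lerDl; apply: sumr_ge0 => k _.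
  by rewrite mulr_ge0 ?divr_ge0 ?exprn_ge0.
rewrite invfM mulrC mulrA ler_pM2r ?invr_gt0 ?exprn_gt0//.
have p4 : 0 < 4 ^- i / 4 :> R by rewrite divr_gt0// invr_gt0 exprn_gt0.
rewrite -[leRHS]invrK lef_pV2 ?posrE ?exprn_gt0 ?invr_gt0 ?mulr_gt0 ?exprn_gt0//.
apply: le_trans low2; rewrite -{2}(prednK i0) exprS; move: (4 ^+ _) (exprn_gt0 i.-1 (ltr0n R 4)) => z z0.
by rewrite le_eqVlt; apply/orP; left; apply/eqP; field; rewrite gt_eqF.
Qed.

Lemma sum_sqV_le (R : realType) (Q : nat) : \sum_(1 <= m < Q) (m%:R ^+ 2)^-1 <= 2 :> R.
Proof.
suff : \sum_(1 <= m < Q) (m%:R ^+ 2)^-1 <= 2 - Q.-1%:R^-1 :> R.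
  have : 0 <= Q.-1%:R^-1 :> R by rewrite invr_ge0.
  by move=> h1 h2; lra.
case: Q => [|[|Q]]; [by rewrite big_geq//= invr0; lra|by rewrite big_geq//= invr0; lra|].
elim: Q => [|Q IH]; first by rewrite big_nat1/= expr1n invr1; lra.
rewrite big_nat_recr//=; move: IH; rewrite /=.
set S := \sum_(1 <= i < Q.+2) _ => IH.
have q1 : 0 < Q.+1%:R :> R by rewrite ltr0n.
have -> : Q.+2%:R = Q.+1%:R + 1 :> R by rewrite natr1.
set z := Q.+1%:R in IH q1 *.
suff h : ((z + 1) ^+ 2)^-1 <= z^-1 - (z + 1)^-1.
  by apply: le_trans (lerD IH h) _; rewrite addrA subrK.
clear IH; clearbody z S.
have -> : z^-1 - (z + 1)^-1 = (z * (z + 1))^-1 by field; rewrite !gt_eqF//; lra.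
rewrite lef_pV2 ?posrE ?exprn_gt0 ?mulr_gt0//; try lra.
Qed.

(** Dirichlet's theorem with bound [16 ^ j]. The first condition excludes denominators up to
    [16 ^ (j - 1)], which yields the error [16 / (16 ^ j) ^ 2]; the other two feed [dyad_sum], whose
    factor 16 turns [2 ^ 14] into [2 ^ 18]. *)
Lemma good_approx (R : realType) (j : nat) (x : R) : (0 < j)%N ->
  (forall m, (1 <= m < (16 ^ j.-1).+1)%N -> ~ nearint m ((16 ^ j)%:R^-1) x) ->
  (forall m, (1 <= m < 16 ^ j)%N -> ~ nearint m ((64 * m * j)%:R^-1) x) ->
  \sum_(1 <= m < 16 ^ j) \sum_(i <- iota 0 (dyad m j))
     4 ^+ i / m%:R ^+ 2 * \1_(nearint m (2 ^- i)) x <= 2 ^+ 14 * j%:R ^+ 2 :> R ->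
  exists2 y : R, good_frac j y & `|x - y| <= 16 / (16 ^ j)%:R ^+ 2.
Proof.
move=> j0 far1 far2 sum.
have Q0 : (0 < 16 ^ j)%N by rewrite expn_gt0.
have [q [p [/andP[q0 qQ] qx pq]]] := dirichlet_primitive x Q0.
have qlow : (16 ^ j.-1 < q)%N.
  rewrite ltnNge; apply/negP => h; apply: (far1 q); first by rewrite q0 ltnS.
  by exists p.
have qR : 0 < q%:R :> R by rewrite ltr0n.
have QR : 0 < (16 ^ j)%:R :> R by rewrite ltr0n.
exists (p%:~R / q%:R); last first.
  have -> : x - p%:~R / q%:R = (q%:R * x - p%:~R) / q%:R by field; rewrite gt_eqF.
  rewrite normrM normfV (gtr0_norm qR) expr2 invfM mulrA.
  apply: le_trans (_ : (16 ^ j)%:R^-1 / q%:R <= _); first by rewrite ler_pM2r ?invr_gt0.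
  rewrite mulrC ler_pM2r ?invr_gt0// -[leRHS]invrK lef_pV2 ?posrE ?invr_gt0 ?divr_gt0//.
  rewrite invfM invrK mulrC ler_pdivrMr//.
  have : (16 ^ j.-1)%:R <= q%:R :> R by rewrite ler_nat ltnW.
  by rewrite -{2}(prednK j0) expnS natrM; lra.
exists q, p; split => //; first by rewrite qlow.
have qx' : `|q%:R * x - p%:~R| <= q%:R^-1.
  by apply: (le_trans qx); rewrite lef_pV2 ?posrE// ler_nat.
apply: le_trans (_ : \sum_(1 <= m < q) 16 * \sum_(i <- iota 0 (dyad m j))
     4 ^+ i / m%:R ^+ 2 * \1_(nearint m (2 ^- i)) x <= _ :> R).
  rewrite !big_nat; apply: ler_sum => m mq; apply: dyad_sum => //.
  by apply: far2; case/andP: mq => -> mq /=; exact: leq_trans qQ.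
rewrite -mulr_sumr; move: sum; rewrite (@big_cat_nat _ _ _ q)//=; last first.
set S1 := \sum_(1 <= m < q) _; set S2 := \sum_(q <= m < _) _.
have : 0 <= S2.
  apply: sumr_ge0 => m _; apply: sumr_ge0 => i _.
  by rewrite mulr_ge0 ?divr_ge0 ?exprn_ge0.
move=> h1 h2; have : 16 * S1 <= 16 * (2 ^+ 14 * j%:R ^+ 2) by rewrite ler_pM2l//; lra.
move/le_trans; apply; lra.
Qed.

Lemma sum_pow2_le (R : realType) (n : nat) : \sum_(i <- iota 0 n) 2 ^+ i <= 2 ^+ n :> R.
Proof.
elim: n => [|n IH]; first by rewrite big_nil.
rewrite -addn1 iotaD big_cat/= big_cons big_nil addr0 add0n exprD expr1; lra.
Qed.

Lemma dyad_le (m j : nat) : (0 < m)%N -> (0 < j)%N -> (2 ^ dyad m j <= 128 * m * j)%N.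
Proof.
move=> m0 j0; have h : (2 ^ trunc_log 2 (64 * m * j) <= 64 * m * j)%N.
  by apply: trunc_logP => //; rewrite !muln_gt0 m0 j0.
by rewrite /dyad expnS (leq_trans (leq_mul (leqnn 2) h))// !mulnA.
Qed.

(** * Measure of the points without a good approximation *)

Section Bad.
Variables (R : realType) (u v : R) (j : nat).
Hypotheses (uv : u < v) (j0 : (0 < j)%N).
Let Q := (16 ^ j)%N.
Let l := v - u.
Let I := `[u, v]%classic.

Let l0 : 0 < l. Proof. by rewrite subr_gt0. Qed.
Let jR : 1 <= j%:R :> R. Proof. by rewrite ler1n. Qed.
Let jn0 : j%:R != 0 :> R. Proof. by rewrite pnatr_eq0 -lt0n. Qed.
Let QE : Q = (2 ^ (4 * j))%N.
Proof. by rewrite expnM (_ : (2 ^ 4 = 16)%N). Qed.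
Let Q0 : (0 < Q)%N. Proof. by rewrite /Q expn_gt0. Qed.
Let QR : 0 < Q%:R :> R. Proof. by rewrite ltr0n. Qed.

Let harm q : (q <= Q)%N -> \sum_(1 <= s < q) s%:R^-1 <= 4 * j%:R :> R.
Proof. by move=> qQ; have := @harmonic_le R q (4 * j); rewrite natrM -QE; apply. Qed.

Definition bad1 : set R := \big[setU/set0]_(m <- index_iota 1 (16 ^ j.-1).+1)
  (I `&` nearint m (Q%:R^-1)).
Definition bad2 : set R := \big[setU/set0]_(m <- index_iota 1 Q)
  (I `&` nearint m ((64 * m * j)%:R^-1)).
Definition pairs := [seq (m, i) | m <- index_iota 1 Q, i <- iota 0 (dyad m j)].
Definition bad3 : set R := [set x | 2 ^+ 14 * j%:R ^+ 2 <=
  \sum_(k <- pairs) 4 ^+ k.2 / k.1%:R ^+ 2 * \1_(I `&` nearint k.1 (2 ^- k.2)) x :> R].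

Let mI m t : measurable (I `&` nearint m t).
Proof. by apply: measurableI; [exact: measurable_itv|exact: measurable_nearint]. Qed.

Lemma measurable_bad1 : measurable bad1.
Proof. by apply: measurable_bigU => m _; exact: mI. Qed.

Lemma measurable_bad2 : measurable bad2.
Proof. by apply: measurable_bigU => m _; exact: mI. Qed.

(** There are [Q / 16] values of [m], each taking a proportion [2 / Q] of the interval: the ratio 16
    between levels makes this [l / 8]. The boundary terms add up to [32 j / Q], and [j ^ 2 <= Q]. *)
Lemma mu_bad1 : (mu bad1 <= (l / 8 + 32 / j%:R)%:E)%E.
Proof.
apply: (le_trans (mu_bigU_le (r := fun m => (l + 4 / m%:R) * (2 * Q%:R^-1)) _ _)).
- by move=> m _; exact: mI.
- move=> m; rewrite mem_index_iota => /andP[m0 _]; apply: mu_nearint => //; last exact: ltW.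
  by rewrite invr_ge0 ltW//= invf_le1// ler1n.
rewrite lee_fin -mulr_suml big_split/= -mulr_sumr.
have le16 : ((16 ^ j.-1).+1 <= Q)%N.
  by rewrite /Q -{2}(prednK j0) expnS; have := expn_gt0 16 j.-1; lia.
have := harm le16; rewrite sumr_const_nat subSS subn0 -(mulr_natr l).
set S := \sum_(1 <= s < _) _ => HS.
have EQ : Q%:R = 16 * (16 ^ j.-1)%:R :> R by rewrite /Q -{1}(prednK j0) expnS natrM.
have jQ : j%:R ^+ 2 <= Q%:R :> R.
  have E : (4 * j = 2 * j * 2)%N := mulnAC 2 2 j.
  rewrite -natrX ler_nat QE E expnM leq_exp2r// (leq_trans (ltnW (ltn_expl j (isT : 1 < 2)%N)))//.
  by rewrite leq_exp2l// leq_pmull.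
rewrite mulrA ler_pdivrMr//.
have -> : (l / 8 + 32 / j%:R) * Q%:R = l / 8 * Q%:R + 32 * (Q%:R / j%:R) by ring.
have h : j%:R <= Q%:R / j%:R :> R by rewrite ler_pdivlMr -?expr2 ?ltr0n.
rewrite EQ in h *; lra.
Qed.

(** The factor [1 / j] in the radius compensates the harmonic sum, at most [4 j], and the constant
    64 makes the proportion [1 / 8]. *)
Lemma mu_bad2 : (mu bad2 <= (l / 8 + j%:R^-1)%:E)%E.
Proof.
apply: (le_trans (mu_bigU_le (r := fun m => (l + 4 / m%:R) * (2 * (64 * m * j)%:R^-1)) _ _)).
- by move=> m _; exact: mI.
- move=> m; rewrite mem_index_iota => /andP[m0 _]; apply: mu_nearint => //; last exact: ltW.
  by rewrite invr_ge0 ler0n/= invf_le1 ?ltr0n ?ler1n ?muln_gt0 ?m0.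
have -> : \sum_(m <- index_iota 1 Q) (l + 4 / m%:R) * (2 * (64 * m * j)%:R^-1) =
   (l * \sum_(1 <= m < Q) m%:R^-1 + 4 * \sum_(1 <= m < Q) (m%:R ^+ 2)^-1) / (32 * j%:R).
  rewrite !mulr_sumr -big_split/= mulr_suml !big_nat; apply: eq_bigr => m /andP[m0 _].
  have mR : m%:R != 0 :> R by rewrite pnatr_eq0 -lt0n.
  by rewrite !natrM; field; rewrite jn0 mR.
rewrite lee_fin ler_pdivrMr; last by rewrite mulr_gt0 ?ltr0n.
have -> : (l / 8 + j%:R^-1) * (32 * j%:R) = 4 * l * j%:R + 32 by field.
have := ler_wpM2l (ltW l0) (harm (leqnn Q)); have := sum_sqV_le R Q; lra.
Qed.

(** Markov's inequality. Scale [i] has weight [4 ^ i] and measure of order [2 ^ (- i)], so the sum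
    over [i] is dominated by its last scale, at most [128 m j]; the sum over [m] then has order
    [l j ^ 2], a sixteenth of the threshold up to boundary terms. *)
Lemma bad3P : measurable bad3 /\ (mu bad3 <= (l / 16 + j%:R^-1)%:E)%E.
Proof.
have la0 : 0 < 2 ^+ 14 * j%:R ^+ 2 :> R by rewrite mulr_gt0// exprn_gt0// ltr0n.
have w0 (k : nat * nat) : 0 <= 4 ^+ k.2 / k.1%:R ^+ 2 :> R by rewrite divr_ge0// exprn_ge0.
have rS : {in pairs, forall k : nat * nat, (mu (I `&` nearint k.1 (2 ^- k.2)) <=
    ((l + 4 / k.1%:R) * (2 * 2 ^- k.2))%:E)%E}.
  move=> k /allpairsPdep[m [i [+ _ ->]]] /=.
  rewrite mem_index_iota => /andP[m0 _]; apply: mu_nearint => //; last exact: ltW.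
  by rewrite invr_ge0 exprn_ge0//= invf_le1 ?exprn_gt0// exprn_ege1// ler1n.
have [mb3 mub3] := markov_indic w0 (fun k => mI k.1 (2 ^- k.2)) rS la0.
split => //; apply: (le_trans mub3); rewrite lee_fin ler_pdivrMr//.
rewrite /pairs big_allpairs_dep/=.
apply: le_trans (_ : \sum_(1 <= m < Q) 256 * j%:R * (l / m%:R + 4 * (m%:R ^+ 2)^-1) <= _).
  rewrite !big_nat; apply: ler_sum => m /andP[m0 _].
  have mR : 0 < m%:R :> R by rewrite ltr0n.
  have -> : \sum_(i <- iota 0 (dyad m j)) 4 ^+ i / m%:R ^+ 2 * ((l + 4 / m%:R) * (2 * 2 ^- i)) =
      (\sum_(i <- iota 0 (dyad m j)) 2 ^+ i) * (2 / m%:R * (l / m%:R + 4 * (m%:R ^+ 2)^-1)).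
    rewrite mulr_suml; apply: eq_bigr => i _.
    have -> : 4 ^+ i = 2 ^+ i * 2 ^+ i :> R by rewrite -exprMn; congr (_ ^+ _); ring.
    have : 2 ^+ i != 0 :> R by rewrite expf_neq0.
    by move: (2 ^+ i) => z z0; field; rewrite z0 gt_eqF.
  have c0 : 0 <= l / m%:R + 4 * (m%:R ^+ 2)^-1.
    by rewrite addr_ge0// ?mulr_ge0// ?invr_ge0 ?exprn_ge0// ltW// divr_gt0.
  rewrite mulrA; apply: ler_wpM2r => //; rewrite mulrA ler_pdivrMr//.
  have : \sum_(i <- iota 0 (dyad m j)) 2 ^+ i <= (128 * m * j)%:R :> R.
    by apply: (le_trans (sum_pow2_le _ _)); rewrite -natrX ler_nat dyad_le.
  by rewrite !natrM; lra.
rewrite -mulr_sumr big_split/= -!mulr_sumr.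
have -> : (l / 16 + j%:R^-1) * (2 ^+ 14 * j%:R ^+ 2) = 256 * j%:R * (4 * l * j%:R + 64).
  by rewrite !exprS expr0; field.
apply: ler_wpM2l; first by rewrite mulr_ge0.
have := ler_wpM2l (ltW l0) (harm (leqnn Q)); have := sum_sqV_le R Q; lra.
Qed.

(** The three exceptional sets take [1 / 8 + 1 / 8 + 1 / 16] of the interval, and the rest is
    covered by intervals of length [32 / Q ^ 2] around the good fractions. *)
Lemma good_count_aux (s : seq R) :
  (forall y, good_frac j y -> u - 16 / Q%:R ^+ 2 <= y <= v + 16 / Q%:R ^+ 2 -> y \in s) ->
  l <= (5 / 16) * l + 34 / j%:R + (size s)%:R * (32 / Q%:R ^+ 2).
Proof.
move=> Hs; set r := 16 / Q%:R ^+ 2 in Hs *.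
pose C := \big[setU/set0]_(y <- s) `[y - r, y + r]%classic.
have mC : measurable C by apply: measurable_bigU => y _; exact: measurable_itv.
have r0 : 0 <= r by rewrite divr_ge0// exprn_ge0.
have muC : (mu C <= ((size s)%:R * (2 * r))%:E)%E.
  apply: (le_trans (mu_bigU_le (r := fun=> 2 * r) _ _)).
  - by move=> y _; exact: measurable_itv.
  - by move=> y _; rewrite mu_itvcc ?lee_fin; lra.
  by rewrite lee_fin big_const_seq count_predT iter_addr_0 -[leLHS]mulr_natl.
have [m3 mu3] := bad3P.
have m1 := measurable_bad1; have m2 := measurable_bad2.
have sub : I `<=` bad1 `|` (bad2 `|` (bad3 `|` C)).
  move=> x Ix; have [b1|b1] := pselect (bad1 x); first by left.
  right; have [b2|b2] := pselect (bad2 x); first by left.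
  right; have [b3|b3] := pselect (bad3 x); first by left.
  right; have [m mQ h|m mQ h||y gy xy] := @good_approx R j x j0.
  - by apply: b1; apply/in_bigU; exists m => //; rewrite mem_index_iota.
  - by apply: b2; apply/in_bigU; exists m => //; rewrite mem_index_iota.
  - move/negP: b3; rewrite -ltNge /pairs big_allpairs_dep/= => /ltW; apply: le_trans.
    apply: ler_sum => m _; apply: ler_sum => i _; apply: ler_wpM2l.
      by rewrite divr_ge0// exprn_ge0.
    rewrite !indicE; case: (boolP (x \in nearint _ _)) => //.
    by rewrite inE => h; rewrite mem_set.
  apply/in_bigU; exists y; last first.
    by rewrite /= in_itv/=; move: xy; rewrite ler_norml -/r => /andP[]; lra.
  apply: Hs => //; move: Ix; rewrite /I/= in_itv/= => /andP[ux xv].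
  by move: xy; rewrite ler_norml => /andP[]; rewrite -/r => *; apply/andP; split; lra.
have mU3 : measurable (bad3 `|` C) by exact: measurableU.
have mU2 : measurable (bad2 `|` (bad3 `|` C)) by exact: measurableU.
have h0 := le_mu (measurable_itv _) (measurableU _ _ m1 mU2) sub.
have h1 := measureU2 (@lebesgue_measure R) m1 mU2.
have h2 := measureU2 (@lebesgue_measure R) m2 mU3.
have h3 := measureU2 (@lebesgue_measure R) m3 mC.
have : ((l)%:E <= (l / 8 + 32 / j%:R)%:E + ((l / 8 + j%:R^-1)%:E + ((l / 16 + j%:R^-1)%:E +
     ((size s)%:R * (2 * r))%:E)))%E.
  rewrite -(mu_itvcc (ltW uv)); apply: (le_trans h0); apply: (le_trans h1).
  apply: leeD; first exact: mu_bad1.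
  apply: (le_trans h2); apply: leeD; first exact: mu_bad2.
  by apply: (le_trans h3); exact: leeD.
by rewrite -!EFinD lee_fin /r; lra.
Qed.
End Bad.

Lemma good_count (R : realType) (u v : R) : u < v -> exists j0 : nat, forall j : nat, (j0 <= j)%N ->
  forall s : seq R,
  (forall y, good_frac j y ->
     u - 16 / (16 ^ j)%:R ^+ 2 <= y <= v + 16 / (16 ^ j)%:R ^+ 2 -> y \in s) ->
  (v - u) * (16 ^ j)%:R ^+ 2 / 64 <= (size s)%:R.
Proof.
(* From [182 / (v - u)] on, [34 / j] is at most [3 / 16] of the length, so that half of the interval
   remains to be covered. *)
move=> uv; exists (Num.truncn (182 / (v - u))).+1 => j jj s Hs.
have l0 : 0 < v - u by rewrite subr_gt0.
have j0 : (0 < j)%N by apply: leq_trans jj.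
have jR : 0 < j%:R :> R by rewrite ltr0n.
have hj : 34 / j%:R <= 3 / 16 * (v - u).
  rewrite ler_pdivrMr//.
  have : 182 / (v - u) < j%:R by apply: lt_le_trans (truncnS_gt _) _; rewrite ler_nat.
  by rewrite ltr_pdivrMr//; lra.
have := good_count_aux uv j0 Hs.
have Q2 : 0 < (16 ^ j)%:R ^+ 2 :> R by rewrite exprn_gt0// ltr0n expn_gt0.
move=> h; have {}h : (v - u) / 2 <= (size s)%:R * (32 / (16 ^ j)%:R ^+ 2) by lra.
by move: h; rewrite mulrA ler_pdivlMr//; lra.
Qed.

(** * Separation and enumeration of the good fractions *)

Lemma frac_sep (R : realType) (p p' : int) (q q' : nat) : (0 < q)%N -> (0 < q')%N ->
  p%:~R / q%:R != p'%:~R / q'%:R :> R ->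
  (q%:R * q'%:R)^-1 <= `|p%:~R / q%:R - p'%:~R / q'%:R| :> R.
Proof.
move=> q0 q0' neq.
have qR : 0 < q%:R :> R by rewrite ltr0n.
have qR' : 0 < q'%:R :> R by rewrite ltr0n.
have qq : 0 < q%:R * q'%:R :> R by rewrite mulr_gt0.
have E : p%:~R / q%:R - p'%:~R / q'%:R = (p * q'%:Z - p' * q%:Z)%:~R / (q%:R * q'%:R) :> R.
  by rewrite intrB !intrM -!pmulrn; field; rewrite !gt_eqF.
rewrite E normrM normfV (gtr0_norm qq) -[leLHS]mul1r ler_pM2r ?invr_gt0//.
have : (p * q'%:Z - p' * q%:Z) != 0.
  by apply: contraNneq neq => z; rewrite -subr_eq0 E z mul0r.
by rewrite -intr_norm (ler_int R 1) -gtz0_ge1 normr_gt0.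
Qed.

Lemma good_frac_sep (R : realType) (i j : nat) (y y' : R) : good_frac i y -> good_frac j y' ->
  y != y' -> ((16 ^ i)%:R * (16 ^ j)%:R)^-1 <= `|y - y'|.
Proof.
move=> [q [p [/andP[q1 q2] _ -> _]]] [q' [p' [/andP[q1' q2'] _ -> _]]] neq.
have q0 : (0 < q)%N by apply: leq_ltn_trans q1.
have q0' : (0 < q')%N by apply: leq_ltn_trans q1'.
apply: le_trans (frac_sep q0 q0' neq).
rewrite lef_pV2 ?posrE ?mulr_gt0 ?ltr0n ?expn_gt0//.
by apply: ler_pM => //; rewrite ler_nat.
Qed.

(** The denominators at the two levels lie in disjoint ranges, and the larger one is the least
    denominator of [y']. *)
Lemma good_frac_neq (R : realType) (i j : nat) (y y' : R) : (i < j)%N ->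
  good_frac i y -> good_frac j y' -> y != y'.
Proof.
move=> ij [q [p [/andP[q1 q2] _ -> _]]] [q' [p' [/andP[q1' q2'] pq' -> _]]].
have q0 : (0 < q)%N by apply: leq_ltn_trans q1.
have q0' : (0 < q')%N by apply: leq_ltn_trans q1'.
have qq : (q < q')%N.
  apply: leq_ltn_trans q1'; apply: (leq_trans q2); rewrite leq_exp2l//.
  by rewrite -ltnS prednK// (leq_trans _ ij).
have /(pq' q p) : (0 < q < q')%N by rewrite q0.
apply: contraNneq => E; have qR : q%:R != 0 :> R by rewrite pnatr_eq0 -lt0n.
have qR' : q'%:R != 0 :> R by rewrite pnatr_eq0 -lt0n.
apply/eqP/(@mulrIz R 1 (oner_neq0 _)); rewrite !intrM -!pmulrn.
have -> : p'%:~R = p'%:~R / q'%:R * q'%:R :> R by rewrite divfK.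
by rewrite -E; field.
Qed.

Definition separated (R : realType) (d : R) (s : seq R) : Prop :=
  {in s &, forall y y', y != y' -> d <= `|y - y'|}.

Lemma mu_sep_union (R : realType) (s : seq R) (d c w : R) : uniq s -> separated d s ->
  0 <= w <= d ->
  (mu (\big[setU/set0]_(y <- s) `[(y + c)%R, (y + c + w)%R[%classic) = ((size s)%:R * w)%:E)%E.
Proof.
move=> us ds /andP[w0 wd]; elim: s us ds => [|y s IH] /=.
  by rewrite big_nil measure0 mul0r.
move=> /andP[ys us] ds; rewrite big_cons measureU/=; first last.
- apply/seteqP; split => x //= [] /=; rewrite in_itv/= => /andP[x1 x2] /in_bigU[z zs].
  rewrite /= in_itv/= => /andP[x3 x4].
  have yz : y != z by apply: contraNneq ys => ->.
  have := ds y z; rewrite !inE eqxx zs orbT => /(_ isT isT yz).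
  by rewrite leNgt => /negP; apply; rewrite ltr_norml; apply/andP; split; lra.
- by apply: measurable_bigU => z _; exact: measurable_itv.
- exact: measurable_itv.
rewrite IH//; last by move=> a b az bz; apply: ds; rewrite inE ?az ?bz orbT.
rewrite mu_itvco; last by rewrite lerDl.
by rewrite -EFinD -natr1 mulrDl mul1r addrC; congr (_ + _)%:E; ring.
Qed.

Lemma pack (R : realType) (s : seq R) (a b d : R) : uniq s -> separated d s -> 0 <= d ->
  a <= b -> {in s, forall y, a <= y <= b} -> (size s)%:R * d <= b - a + d.
Proof.
move=> us ds d0 ab sab.
have dd : 0 <= d <= d by rewrite d0 lexx.
rewrite -lee_fin -(mu_sep_union 0 us ds dd).
have -> : ((b - a + d)%:E = mu `[a, (b + d)%R[%classic)%E by rewrite mu_itvco; [congr EFin; ring|lra].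
apply: le_mu => [||x /in_bigU[y ys]].
- by apply: measurable_bigU => y _; exact: measurable_itv.
- exact: measurable_itv.
have /andP[] := sab _ ys; rewrite /= !in_itv/= => ay yb /andP[h1 h2]; apply/andP; split; lra.
Qed.

(** By [pack] the lists of distinct elements have bounded length; a longest one contains
    everything. *)
Lemma sep_enum (R : realType) (Y : set R) (a b d : R) : 0 < d -> a <= b ->
  (forall y y', Y y -> Y y' -> y != y' -> d <= `|y - y'|) ->
  exists2 s : seq R, uniq s & forall y, y \in s <-> (Y y /\ a <= y <= b).
Proof.
move=> d0 ab sepY.
pose ok (s : seq R) := uniq s /\ (forall y, y \in s -> Y y /\ a <= y <= b).
pose P n := `[< exists s, ok s /\ size s = n >].
have exP : exists n, P n by exists 0%N; apply/asboolP; exists [::]; split.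
have bound n : P n -> (n <= Num.truncn ((b - a + d) / d))%N.
  move=> /asboolP[s [[us sY] <-]].
  have : (size s)%:R <= (b - a + d) / d.
    rewrite ler_pdivlMr//; apply: pack => //; [|exact: ltW|by move=> y /sY[]].
    by move=> y y' /sY[Yy _] /sY[Yy' _]; exact: sepY.
  by move=> h; rewrite truncn_ge_nat// (le_trans _ h).
case: (ex_maxnP exP bound) => n /asboolP[s [[us sY] sn]] nmax.
exists s => // y; split; first exact: sY.
move=> [Yy yab]; apply: contrapT => /negP ys.
have /nmax : P n.+1.
  apply/asboolP; exists (y :: s); rewrite /= sn; split => //; split; first by rewrite /= ys.
  by move=> z; rewrite inE => /orP[/eqP->|/sY].
by rewrite ltnn.
Qed.

(** * Quasi-independence *)

Section Hits.
Variables (R : realType) (A : nat -> R).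
Hypothesis (A1 : forall j, (0 < j)%N -> j%:R <= A j).
Hypothesis (Amono : forall i j, (0 < i)%N -> (i <= j)%N -> A i <= A j).

Definition len (j : nat) : R := ((16 ^ j)%:R ^+ 2 * A j)^-1.

(** Only the outer half of the one-sided neighbourhood is kept: a lower bound on the distance to [y]
    is what later bounds [1 / (q ^ 2 d)], hence the range of [N], from above. *)
Definition cell (j : nat) (y : R) : set R := `[(y + len j / 2)%R, (y + len j / 2 + len j / 2)%R[%classic.

Definition hits (j : nat) : set R := [set x | exists2 y, good_frac j y & cell j y x].

Let QR j : 0 < (16 ^ j)%:R :> R. Proof. by rewrite ltr0n expn_gt0. Qed.
Let Q2R j : 0 < (16 ^ j)%:R ^+ 2 :> R. Proof. by rewrite exprn_gt0. Qed.
Let A1' j : (0 < j)%N -> 1 <= A j.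
Proof. by move=> j0; apply: le_trans (A1 j0); rewrite ler1n. Qed.
Let A0 j : (0 < j)%N -> 0 < A j.
Proof. by move=> j0; apply: lt_le_trans (A1' j0). Qed.
Let len0 j : (0 < j)%N -> 0 < len j.
Proof. by move=> j0; rewrite invr_gt0 mulr_gt0// A0. Qed.
Let lenQ j : (0 < j)%N -> (16 ^ j)%:R ^+ 2 * len j = (A j)^-1.
Proof.
by move=> j0; rewrite /len invfM mulrA mulfV ?mul1r// gt_eqF.
Qed.
Let len_le j : (0 < j)%N -> len j <= ((16 ^ j)%:R ^+ 2)^-1.
Proof.
move=> j0; by rewrite /len lef_pV2 ?posrE ?mulr_gt0 ?A0// ler_peMr ?A1'.
Qed.
Let len_anti i j : (0 < i)%N -> (i <= j)%N -> len j <= len i.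
Proof.
move=> i0 ij; have j0 : (0 < j)%N by apply: leq_trans ij.
rewrite /len lef_pV2 ?posrE ?mulr_gt0 ?A0//.
apply: ler_pM; [exact: ltW|exact/ltW/A0| |exact: Amono].
by rewrite lerXn2r ?nnegrE// ler_nat leq_exp2l.
Qed.

Lemma measurable_cell j y : measurable (cell j y).
Proof. exact: measurable_itv. Qed.

Lemma measurable_hits j : measurable (hits j).
Proof.
pose F (k : nat * int) : set R := [set x | good_frac j (k.2%:~R / k.1%:R : R) /\
   cell j (k.2%:~R / k.1%:R) x].
have -> : hits j = \bigcup_(k in [set: nat * int]) F k.
  apply/seteqP; split => x.
    by move=> [y gy xy]; have [q [p [_ _ E _]]] := gy; exists (q, p) => //; rewrite /F/= -E.
  by move=> [k _ [gk xk]]; exists (k.2%:~R / k.1%:R).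
apply: countable_bigcupT_measurable => // k.
have [gk|gk] := pselect (good_frac j (k.2%:~R / k.1%:R : R)).
  have -> : F k = cell j (k.2%:~R / k.1%:R) by apply/seteqP; split => [x []|x].
  exact: measurable_cell.
have -> : F k = set0 by apply/seteqP; split => [x []|x].
exact: measurable0.
Qed.

Definition cells (j : nat) (s : seq R) : set R := \big[setU/set0]_(y <- s) cell j y.

Lemma measurable_cells j s : measurable (cells j s).
Proof. by apply: measurable_bigU => y _; exact: measurable_cell. Qed.

Let sepQ j (s : seq R) : (forall y, y \in s -> good_frac j y) ->
  separated ((16 ^ j)%:R ^+ 2)^-1 s.
Proof.
by move=> gs y y' /gs gy /gs gy' neq; rewrite expr2; exact: good_frac_sep gy gy' neq.
Qed.

Lemma mu_cells j (s : seq R) : (0 < j)%N -> uniq s -> (forall y, y \in s -> good_frac j y) ->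
  (mu (cells j s) = ((size s)%:R * (len j / 2))%:E)%E.
Proof.
move=> j0 us gs; apply: (mu_sep_union _ us (sepQ gs)).
by have := len0 j0; have := len_le j0 => h1 h2; apply/andP; split; lra.
Qed.

Lemma size_good_le j (s : seq R) (a b : R) : uniq s ->
  (forall y, y \in s -> good_frac j y /\ a <= y <= b) -> a <= b ->
  (size s)%:R <= (b - a) * (16 ^ j)%:R ^+ 2 + 1.
Proof.
move=> us gs ab; have h := pack us (sepQ (fun y ys => (gs y ys).1)) _ ab (fun y ys => (gs y ys).2).
have {}h : (size s)%:R * ((16 ^ j)%:R ^+ 2)^-1 <= b - a + ((16 ^ j)%:R ^+ 2)^-1.
  by apply: h; rewrite invr_ge0 ltW.
have := ler_wpM2r (ltW (Q2R j)) h.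
by rewrite mulrDl mulVf ?gt_eqF// divfK ?gt_eqF.
Qed.

(** Separation allows at most [Q ^ 2 len i + 1] fractions of level [j] near a cell of level [i],
    with [Q = 16 ^ j]. Once the 1 is absorbed, multiplying by [len j / 2] gives [len i / A j], as
    for independent events. *)
Lemma mu_cell_cells i j y (s : seq R) : (0 < i)%N -> (i < j)%N -> good_frac i y ->
  uniq s -> (forall z, z \in s -> good_frac j z) ->
  (mu (cell i y `&` cells j s) <= (len i / A j)%:E)%E.
Proof.
move=> i0 ij gy us gs; have j0 : (0 < j)%N by apply: ltn_trans ij.
have Lij := len_anti i0 (ltnW ij).
have Li := len0 i0; have Lj := len0 j0.
pose lo := y + len i / 2 - len j; pose hi := y + len i - len j / 2.
pose t := [seq z <- s | lo <= z <= hi].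
have ut : uniq t by exact: filter_uniq.
have gt z : z \in t -> good_frac j z /\ lo <= z <= hi.
  by rewrite mem_filter => /andP[zz /gs].
have sub : cell i y `&` cells j s `<=` cells j t.
  move=> x [xy /in_bigU[z zs xz]]; apply/in_bigU; exists z => //.
  rewrite mem_filter zs andbT; move: xy xz; rewrite /cell/= !in_itv/= => /andP[h1 h2] /andP[h3 h4].
  by rewrite /lo /hi; apply/andP; split; lra.
apply: (le_trans (le_mu _ _ sub)).
- by apply: measurableI; [exact: measurable_cell|exact: measurable_cells].
- exact: measurable_cells.
rewrite mu_cells//; last by move=> z /gt[].
rewrite lee_fin; case: (posnP (size t)) => [->|t0].
  by rewrite mul0r divr_ge0// ltW// A0.
have [z zt] : exists z, z \in t by case: (t) t0 => // z ? _; exists z; rewrite inE eqxx.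
have [gz zz] := gt z zt.
have yz := good_frac_neq ij gy gz.
have h1 := good_frac_sep gy gz yz.
have h2 : `|y - z| <= len i.
  by move: zz; rewrite /lo /hi ler_norml => /andP[h2 h3]; apply/andP; split; lra.
(* If any fraction of level [j] is present, its separation from [y] is at most [len i]. This forces
   [16 ^ j >= 16 ^ i * A i], so that [len i] is at least the spacing at level [j] and the 1 is
   absorbed. *)
have big : 1 <= (16 ^ j)%:R ^+ 2 * len i.
  have h3 := le_trans h1 h2; set qi := (16 ^ i)%:R : R in h3; set qj := (16 ^ j)%:R : R in h3 *.
  have qi0 : 0 < qi := QR i; have qj0 : 0 < qj := QR j.
  have Ei : qi ^+ 2 * len i * A i = 1 by rewrite lenQ// mulVf// gt_eqF// A0.
  have h4 : qi * A i <= qj.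
    have := ler_wpM2r (ltW (mulr_gt0 (mulr_gt0 (mulr_gt0 qi0 qi0) qj0) (A0 i0))) h3.
    have -> : (qi * qj)^-1 * (qi * qi * qj * A i) = qi * A i by field; rewrite !gt_eqF.
    have -> : len i * (qi * qi * qj * A i) = qj * (qi ^+ 2 * len i * A i) by ring.
    by rewrite Ei mulr1.
  have h5 : qi <= qj by apply: le_trans h4; rewrite ler_peMr ?A1'// ltW.
  have : qi ^+ 2 * A i <= qj ^+ 2.
    have := ler_pM (ltW qi0) (ltW (mulr_gt0 qi0 (A0 i0))) h5 h4; rewrite !expr2; lra.
  move/(ler_wpM2r (ltW Li)); apply: le_trans.
  by rewrite -Ei mulrAC.
have lohi : lo <= hi by rewrite /lo /hi; lra.
have cnt := size_good_le ut gt lohi.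
have cnt2 : (size t)%:R <= 2 * ((16 ^ j)%:R ^+ 2 * len i).
  apply: (le_trans cnt); have : (hi - lo) * (16 ^ j)%:R ^+ 2 <= len i * (16 ^ j)%:R ^+ 2.
    by rewrite ler_pM2r// /hi /lo; lra.
  by rewrite (mulrC (len i)); move: big; set w := _ * len i; lra.
have := ler_wpM2r (ltW Lj) cnt2.
have -> : 2 * ((16 ^ j)%:R ^+ 2 * len i) * len j = 2 * len i * ((16 ^ j)%:R ^+ 2 * len j) by ring.
rewrite lenQ//; lra.
Qed.

Lemma mu_cells_cells i j (r s : seq R) : (0 < i)%N -> (i < j)%N ->
  uniq s -> (forall z, z \in s -> good_frac j z) -> (forall z, z \in r -> good_frac i z) ->
  (mu (cells i r `&` cells j s) <= ((size r)%:R * (len i / A j))%:E)%E.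
Proof.
move=> i0 ij us gs gr.
have -> : cells i r `&` cells j s = \big[setU/set0]_(y <- r) (cell i y `&` cells j s).
  by rewrite /cells (big_morph (fun X => X `&` _) (fun X Y => setIUl X Y _) (set0I _)).
apply: (le_trans (mu_bigU_le (r := fun=> len i / A j) _ _)).
- by move=> y _; apply: measurableI; [exact: measurable_cell|exact: measurable_cells].
- by move=> y /gr gy; exact: mu_cell_cells.
by rewrite lee_fin big_const_seq count_predT iter_addr_0 -[leLHS]mulr_natl.
Qed.

End Hits.

(** * From quasi-independence to almost every point *)

Lemma bonferroni_step (R : realType) (X Y : set R) (x y z : R) :
  measurable X -> measurable Y -> (x%:E <= mu X)%E -> (y%:E <= mu Y)%E ->
  (mu (X `&` Y) <= z%:E)%E -> ((x + y - z)%:E <= mu (X `|` Y))%E.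
Proof.
move=> mX mY xX yY zXY.
have mU : measurable (X `|` Y) by exact: measurableU.
have := measureDI (@lebesgue_measure R) mU mX.
rewrite setDUl setDv set0U setIidr; last exact: subsetUl.
move=> ->; rewrite addeC -addrA EFinD; apply: leeD => //.
rewrite EFinB leeBlDr//; apply: (le_trans yY).
have := measureDI (@lebesgue_measure R) mY mX => ->.
by apply: leeD => //; rewrite setIC.
Qed.

(** Inclusion-exclusion to second order, with the square of the sum as a bound for the sum over
    pairs. In the application [b j = 1 / A j], and 256 comes from at least [l Q ^ 2 / 128]
    fractions, each with half a cell length. *)
Lemma mu_union_bonferroni (R : realType) (l : R) (b : nat -> R) (C : nat -> set R)
    (J : pred nat) (k0 m : nat) :
  0 <= l ->
  (forall j, measurable (C j)) ->
  (forall j, (k0 <= j)%N -> 0 <= b j) ->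
  (forall j, (k0 <= j)%N -> ((l * (b j / 256))%:E <= mu (C j))%E) ->
  (forall i j, (k0 <= i)%N -> (i < j)%N -> (mu (C i `&` C j) <= (l * (b i * b j))%:E)%E) ->
  ((l * ((\sum_(j <- iota k0 m | J j) b j) / 256 - (\sum_(j <- iota k0 m | J j) b j) ^+ 2))%:E
    <= mu (\big[setU/set0]_(j <- iota k0 m | J j) C j))%E.
Proof.
move=> l0 mC b0 lb pair; elim: m => [|m IH].
  by rewrite !big_nil measure0 mul0r expr0n/= subr0 mulr0.
have -> : iota k0 m.+1 = iota k0 m ++ [:: (k0 + m)%N] by rewrite -addn1 iotaD.
rewrite !big_cat/= !big_cons !big_nil; case: ifPn => Jk; last by rewrite addr0 setU0.
rewrite addr0 setU0.
set k := (k0 + m)%N; have kk : (k0 <= k)%N by exact: leq_addr.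
set S := \sum_(j <- iota k0 m | J j) b j in IH *.
have S0 : 0 <= S.
  rewrite /S big_seq_cond; apply: sumr_ge0 => j /andP[]; rewrite mem_iota => /andP[kj _] _.
  exact: b0.
have mU : measurable (\big[setU/set0]_(j <- iota k0 m | J j) C j).
  by rewrite -big_filter; apply: measurable_bigU => j _; exact: mC.
have inter : (mu ((\big[setU/set0]_(j <- iota k0 m | J j) C j) `&` C k) <= (l * (S * b k))%:E)%E.
  rewrite (big_morph (fun X => X `&` C k) (fun X Y => setIUl X Y _) (set0I _)).
  rewrite -big_filter; apply: (le_trans (mu_bigU_le (r := fun j => l * (b j * b k)) _ _)).
  - by move=> j _; exact: measurableI.
  - move=> j; rewrite mem_filter mem_iota => /andP[_ /andP[kj jk]].
    exact: pair.
  by rewrite big_filter lee_fin -mulr_sumr -mulr_suml.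
apply: le_trans (bonferroni_step mU (mC k) IH (lb k kk) inter).
rewrite lee_fin [leRHS](_ : _ = l * (S / 256 - S ^+ 2 + b k / 256 - S * b k)); last by ring.
apply: ler_wpM2l => //.
have := b0 k kk; have := mulr_ge0 S0 (b0 k kk); have := sqr_ge0 (b k).
rewrite !expr2; nra.
Qed.

Lemma hits_dense (R : realType) (A : nat -> R) (J : pred nat) (u v : R) (j0 : nat) :
  (forall j, (0 < j)%N -> j%:R <= A j) ->
  (forall i j, (0 < i)%N -> (i <= j)%N -> A i <= A j) ->
  (forall (k : nat) (c : R), exists m : nat, c <= \sum_(j <- iota k m | J j) (A j)^-1) ->
  u < v ->
  (((v - u) / 2 ^+ 19)%:E <=
     mu (`[u, v] `&` \bigcup_(j in [set j | (j0 <= j)%N /\ J j]) hits A j))%E.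
Proof.
move=> A1 Amono div uv; set l := v - u; have l0 : 0 < l by rewrite subr_gt0.
(* Nested intervals with margins [l / 8]: fractions counted around [[u1, v1]] lie in [[u2, v2]], and
   the cells attached to those stay in [[u, v]]. *)
pose u1 := u + l / 4; pose v1 := v - l / 4.
pose u2 := u + l / 8; pose v2 := v - l / 8.
have [j1 count] : exists j1 : nat, forall j : nat, (j1 <= j)%N -> forall s : seq R,
  (forall y, good_frac j y -> u1 - 16 / (16 ^ j)%:R ^+ 2 <= y <= v1 + 16 / (16 ^ j)%:R ^+ 2 -> y \in s) ->
  (v1 - u1) * (16 ^ j)%:R ^+ 2 / 64 <= (size s)%:R.
  by apply: good_count; rewrite /u1 /v1 /l; lra.
have QR (j : nat) : 0 < (16 ^ j)%:R :> R by rewrite ltr0n expn_gt0.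
have Q2R (j : nat) : 0 < (16 ^ j)%:R ^+ 2 :> R by rewrite exprn_gt0.
have u2v2 : u2 <= v2 by rewrite /u2 /v2 /l in l0 *; lra.
have sE j : exists s : seq R, uniq s /\ forall y, y \in s <-> (good_frac j y /\ u2 <= y <= v2).
  have d0 : 0 < ((16 ^ j)%:R ^+ 2)^-1 :> R by rewrite invr_gt0.
  have [|s us sP] := @sep_enum R (good_frac j) u2 v2 _ d0 u2v2; last by exists s.
  by move=> y y' gy gy' neq; rewrite expr2; exact: good_frac_sep gy gy' neq.
have [s sP] := choice sE.
pose k0 := maxn (maxn j0 j1) (maxn 1024 (Num.truncn (128 / l)).+1).
have k0P j : (k0 <= j)%N -> [/\ (j0 <= j)%N, (j1 <= j)%N, (0 < j)%N,
    (A j)^-1 <= 1 / 1024 & 16 / (16 ^ j)%:R ^+ 2 <= l / 8].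
  rewrite /k0 !geq_max => /andP[/andP[h1 h2] /andP[h3 h4]].
  have jp : (0 < j)%N by apply: leq_trans h3.
  split => //.
    rewrite div1r lef_pV2 ?posrE ?(lt_le_trans _ (A1 _ jp)) ?ltr0n//.
    by apply: le_trans (A1 _ jp); rewrite ler_nat.
  have h5 : 128 / l < j%:R by apply: lt_le_trans (truncnS_gt _) _; rewrite ler_nat.
  rewrite ltr_pdivrMr// in h5; rewrite ler_pdivrMr//.
  have : j%:R <= (16 ^ j)%:R ^+ 2 :> R.
    rewrite -natrX ler_nat (leq_trans (ltnW (ltn_expl j (isT : 1 < 16)%N)))//.
    by rewrite -mulnn leq_pmulr// expn_gt0.
  by move/(ler_wpM2l (ltW l0)); lra.
have k0_pos : (0 < k0)%N by rewrite /k0 !leq_max orbT.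
pose C j := cells A j (s j).
have cntlo j : (k0 <= j)%N -> l / 128 * (16 ^ j)%:R ^+ 2 <= (size (s j))%:R.
  move=> /k0P[_ jj _ _ small]; have [_ sj] := sP j.
  have := count j jj (s j); rewrite (_ : v1 - u1 = l / 2); last by rewrite /v1 /u1 /l; field.
  move=> h; have {}h : l / 2 * (16 ^ j)%:R ^+ 2 / 64 <= (size (s j))%:R.
    apply: h => y gy /andP[y1 y2]; apply/sj; split => //.
    by rewrite /u2 /v2; rewrite /u1 /v1 in y1 y2; apply/andP; split; lra.
  lra.
have cnthi j : (k0 <= j)%N -> (size (s j))%:R <= l * (16 ^ j)%:R ^+ 2.
  move=> /k0P[_ jj _ _ small]; have [us sj] := sP j.
  have h := @size_good_le R j (s j) u2 v2 us (fun y => (sj y).1) u2v2.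
  apply: (le_trans h); move: small; rewrite ler_pdivrMr// /u2 /v2.
  have -> : v - l / 8 - (u + l / 8) = l * (3 / 4) by rewrite /l; field.
  by set w := (_ ^+ 2); lra.
have lenA j : (16 ^ j)%:R ^+ 2 * len A j = (A j)^-1.
  by rewrite /len invfM mulrA mulfV ?mul1r// gt_eqF.
have len0 j : (k0 <= j)%N -> 0 < len A j.
  move=> /k0P[_ _ jp _ _]; rewrite /len invr_gt0 mulr_gt0//.
  by apply: lt_le_trans (A1 _ jp); rewrite ltr0n.
have b0 j : (k0 <= j)%N -> 0 <= (A j)^-1.
  by move=> kj; rewrite -lenA mulr_ge0 ?ltW// len0.
have mC j : measurable (C j) by exact: measurable_cells.
have lb j : (k0 <= j)%N -> ((l * ((A j)^-1 / 256))%:E <= mu (C j))%E.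
  move=> kj; have [_ _ jp _ _] := k0P j kj; have [us sj] := sP j.
  rewrite mu_cells// => [|y /sj[]//]; rewrite lee_fin -lenA.
  have := ler_wpM2r (ltW (len0 j kj)) (cntlo j kj); lra.
have pair i j : (k0 <= i)%N -> (i < j)%N -> (mu (C i `&` C j) <= (l * ((A i)^-1 * (A j)^-1))%:E)%E.
  move=> ki ij; have [_ _ ip _ _] := k0P i ki.
  have kj : (k0 <= j)%N by apply: leq_trans ki (ltnW ij).
  have [us sj] := sP j; have [_ si] := sP i.
  apply: (le_trans (mu_cells_cells A1 Amono ip ij us _ _)) => [z /sj[]//|z /si[]//|].
  rewrite lee_fin mulrA mulrA; apply: ler_wpM2r; first exact: b0.
  rewrite -(lenA i) mulrA; apply: ler_wpM2r; first exact/ltW/len0.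
  exact: cnthi.
pose S m := \sum_(j <- iota k0 m | J j) (A j)^-1.
have exm : exists m, 1 / 2 ^+ 10 <= S m by exact: div.
(* The sum is stopped as soon as it reaches [2 ^ (- 10)]. Its terms are at most [1 / 1024], so it is
   still at most [2 ^ (- 9)], where [S / 256 - S ^ 2] is at least [2 ^ (- 19)]. *)
case: (ex_minnP exm) => m Sm mmin.
have Sm2 : S m <= 1 / 2 ^+ 9.
  case: m Sm mmin => [|m] Sm mmin; first by rewrite /S big_nil; lra.
  have : S m < 1 / 2 ^+ 10 by rewrite ltNge; apply/negP => /mmin; rewrite ltnn.
  rewrite /S -[in X in _ -> X](addn1 m) iotaD big_cat/= big_cons big_nil.
  have [_ _ _ small _] := k0P (k0 + m)%N (leq_addr _ _).
  by case: ifP => _; lra.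
have main := mu_union_bonferroni J m (ltW l0) mC b0 lb pair.
apply: (@le_trans _ _ (mu (\big[setU/set0]_(j <- iota k0 m | J j) C j))).
  apply: le_trans main; rewrite lee_fin; apply: ler_wpM2l; first exact: ltW.
  rewrite -/(S m); move: (S m) Sm Sm2 => z z1 z2.
  have h1 : 0 <= z - 1 / 2 ^+ 10 by lra.
  have h2 : 0 <= 1 / 2 ^+ 9 - z by lra.
  by have := mulr_ge0 h1 h2; rewrite expr2; lra.
apply: le_mu.
- by rewrite -big_filter; apply: measurable_bigU.
- apply: measurableI; first exact: measurable_itv.
  by apply: bigcup_measurable => j _; exact: measurable_hits.
move=> x; rewrite -big_filter => /in_bigU[j].
rewrite mem_filter mem_iota => /andP[Jj /andP[kj _]] /in_bigU[y ys xy].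
have [jj _ jp Aj small] := k0P j kj; have [_ sj] := sP j.
have [gy /andP[y1 y2]] := (sj y).1 ys.
split; last by exists j => //=; exists y.
have len1 : len A j <= l / 8.
  apply: le_trans small; rewrite -[leLHS]mul1r.
  have -> : len A j = (A j)^-1 / (16 ^ j)%:R ^+ 2 by rewrite -lenA mulrAC mulfV ?mul1r// gt_eqF.
  rewrite mul1r ler_pM2r ?invr_gt0//; lra.
have := len0 j kj; move: xy; rewrite /cell/= !in_itv/= /u2 /v2 in y1 y2 * => /andP[x1 x2] len00.
by apply/andP; split; lra.
Qed.

(** Almost every point outside [B] is a density point of the complement of [B]; but [B] fills at
    least the proportion [c / 2] of every ball, whatever its centre. *)
Lemma ae_of_dense (R : realType) (B : set R) (c : R) : measurable B -> 0 < c ->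
  (forall u v : R, u < v -> (((v - u) * c)%:E <= mu (`[u, v] `&` B))%E) ->
  {ae (@lebesgue_measure R), forall x, B x}.
Proof.
move=> mB c0 dense; have mC : measurable (~` B) by exact: measurableC.
have := lebesgue_density mC.
apply: filter_app; first exact: (ae_filter_ringOfSetsType (@lebesgue_measure R)).
apply: aeW => /= x lim_x; apply: contrapT => nBx.
have lim1 : (lebesgue_measure (~` B `&` ball x r) / lebesgue_measure (ball x r))%E @[r --> 0^'+]
    --> (1%R : R)%:E.
  by move: lim_x; rewrite indicE mem_set.
suff : ((1 : R)%:E <= (1 - c / 2)%:E)%E by rewrite lee_fin; lra.
rewrite -(cvg_lim _ lim1)//; apply: lime_le; first by apply/cvg_ex; exists (1%R : R)%:E.
near=> r.
have r0 : 0 < r by near: r; exact: nbhs_right_gt.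
have r2 : 0 < r *+ 2 by rewrite mulrn_wgt0.
rewrite (lebesgue_measure_ball _ (ltW r0)) inver gt_eqF//.
have mball : measurable (ball x r) by exact: measurable_ball.
have mbb : measurable (ball x r `&` B) by exact: measurableI.
have h1 := measureDI (@lebesgue_measure R) mball mB.
have h2 : ((r * c)%:E <= mu (ball x r `&` B))%E.
  (* The closed interval has half the radius because the ball is open. *)
  have := dense (x - r / 2) (x + r / 2) ltac:(lra).
  have -> : x + r / 2 - (x - r / 2) = r by field.
  move/le_trans; apply; apply: le_mu => //.
    by apply: measurableI => //; exact: measurable_itv.
  move=> y [/=]; rewrite in_itv/= => /andP[y1 y2] By; split => //.
  by rewrite ball_itv/= in_itv/=; apply/andP; split; lra.
have h3 : (mu (~` B `&` ball x r) <= (r *+ 2 - r * c)%:E)%E.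
  rewrite setIC -setDE EFinB -(lebesgue_measure_ball x (ltW r0)) leeBrDr//.
  by rewrite [leRHS]h1 leeD2l.
have : ((r *+ 2 - r * c)%:E * ((r *+ 2)^-1)%:E = (1 - c / 2)%:E)%E.
  by rewrite -EFinM; congr EFin; rewrite -mulr_natr; field; rewrite gt_eqF.
move=> <-; apply: lee_wpmul2r => //.
by rewrite lee_fin invr_ge0 ltW.
Unshelve. all: by end_near. Qed.

Lemma ae_hits_io (R : realType) (A : nat -> R) (J : pred nat) :
  (forall j, (0 < j)%N -> j%:R <= A j) ->
  (forall i j, (0 < i)%N -> (i <= j)%N -> A i <= A j) ->
  (forall (k : nat) (c : R), exists m : nat, c <= \sum_(j <- iota k m | J j) (A j)^-1) ->
  {ae (@lebesgue_measure R), forall x : R,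
    forall j0 : nat, exists j, [/\ (j0 <= j)%N, J j & hits A j x]}.
Proof.
move=> A1 Amono div; apply: ae_foralln => j0.
pose B := \bigcup_(j in [set j | (j0 <= j)%N /\ J j]) hits A j.
have : {ae (@lebesgue_measure R), forall x, B x}.
  apply: (@ae_of_dense R B (2 ^+ 19)^-1).
  - by apply: bigcup_measurable => j _; exact: measurable_hits.
  - by rewrite invr_gt0 exprn_gt0.
  - by move=> u v uv; exact: hits_dense.
apply: filter_app; first exact: (ae_filter_ringOfSetsType (@lebesgue_measure R)).
by apply: aeW => /= x [j [jj Jj] h]; exists j.
Qed.

(** * Divergent series and upper density *)

Lemma upper_density_eq1 (R : realType) (A : pred nat) :
  (forall (e : R) (M0 : nat), 0 < e -> exists M, (M0 <= M)%N /\ 1 - e <= density_seq R A M) ->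
  upper_density R A = 1.
Proof.
move=> H; rewrite /upper_density /limn_sup.
have le1 M : density_seq R A M <= 1.
  rewrite /density_seq; case: M => [|M]; first by rewrite invr0 mulr0.
  by rewrite ler_pdivrMr ?ltr0n// mul1r ler_nat (leq_trans (count_size _ _))// size_iota.
suff -> : sups (density_seq R A) = cst 1 by exact: lim_cst.
apply/funext => n; rewrite /sups/=; apply/eqP; rewrite eq_le; apply/andP; split.
  apply: ge_sup; last by move=> _ [k _ <-].
  by exists (density_seq R A n); exists n => //=.
apply/ler_addgt0Pr => e e0; have [M [nM hM]] := H e n e0.
rewrite -lerBlDr; apply: (le_trans hM); apply: ub_le_sup; last by exists M.
by exists 1 => _ [k _ <-].
Qed.

(** With [i = j / 3] rounded down, [2 ^ j] is at least [(2 ^ i) ^ 3 >= (i + 1) ^ 3], a cube against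
    a square. *)
Lemma pow2_gt_sqr (R : realType) (C : R) : exists j0 : nat, forall j : nat, (j0 <= j)%N ->
  C * j%:R ^+ 2 <= 2 ^+ j.
Proof.
pose B := (Num.truncn `|9 * C|).+1; exists (3 * B)%N => j jB.
pose i := (j %/ 3)%N.
have iB : (B <= i)%N by rewrite /i leq_divRL// mulnC.
have ji : (j <= 3 * i.+1)%N by rewrite mulnC ltnW// ltn_ceil.
have C9 : 9 * C <= i%:R.
  apply: le_trans (ler_norm _) _; apply: le_trans (ltW (truncnS_gt _)) _.
  by rewrite ler_nat.
have h1 : (i.+1 ^ 3 <= 2 ^ j)%N.
  apply: (@leq_trans (2 ^ (i * 3))); last by rewrite leq_exp2l// leq_divM.
  by rewrite expnM leq_exp2r// ltn_expl.
have h2 : i.+1%:R ^+ 3 <= 2 ^+ j :> R by rewrite -!natrX ler_nat.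
have j2 : j%:R ^+ 2 <= 9 * i.+1%:R ^+ 2 :> R.
  have h : j%:R <= 3 * i.+1%:R :> R by rewrite -natrM ler_nat.
  have -> : 9 * i.+1%:R ^+ 2 = (3 * i.+1%:R) ^+ 2 :> R by ring.
  by rewrite lerXn2r ?nnegrE ?mulr_ge0.
apply: le_trans h2.
have [C0|C0] := leP 0 C; last first.
  apply: (@le_trans _ _ 0); last by rewrite exprn_ge0.
  by rewrite nmulr_rle0// exprn_ge0.
apply: (le_trans (ler_wpM2l C0 j2)).
have -> : C * (9 * i.+1%:R ^+ 2) = 9 * C * i.+1%:R ^+ 2 by ring.
rewrite [leRHS]exprS; apply: ler_wpM2r; first exact: sqr_ge0.
by apply: (le_trans C9); rewrite ler_nat.
Qed.

Definition diverges (R : realType) (f : nat -> R) : Prop :=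
  forall (k : nat) (c : R), exists m : nat, c <= \sum_(j <- iota k m) f j.

Lemma sum_iota_ge0 (R : realType) (f : nat -> R) (k m : nat) :
  (forall j, 0 <= f j) -> 0 <= \sum_(j <- iota k m) f j.
Proof. by move=> f0; apply: sumr_ge0. Qed.

Lemma diverges_from (R : realType) (f : nat -> R) (k : nat) : (forall j, 0 <= f j) ->
  (forall c : R, exists m, c <= \sum_(j <- iota k m) f j) -> diverges f.
Proof.
move=> f0 H k' c; have [m hm] := H (c + \sum_(j <- iota 0 k') f j).
exists (k + m)%N.
have E1 : \sum_(j <- iota 0 (k + m)) f j = \sum_(j <- iota 0 k) f j + \sum_(j <- iota k m) f j.
  by rewrite iotaD big_cat.
have E2 : \sum_(j <- iota 0 (k' + (k + m))) f j =
    \sum_(j <- iota 0 k') f j + \sum_(j <- iota k' (k + m)) f j.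
  by rewrite iotaD big_cat.
have E3 : \sum_(j <- iota 0 (k' + (k + m))) f j =
    \sum_(j <- iota 0 (k + m)) f j + \sum_(j <- iota (k + m) k') f j.
  by rewrite addnC iotaD big_cat.
have := sum_iota_ge0 (k + m) k' f0; have := sum_iota_ge0 0 k f0; lra.
Qed.

Lemma diverges_step (R : realType) (f : nat -> R) (e : R) : 0 < e -> (forall j, 0 <= f j) ->
  (forall k : nat, exists m, e <= \sum_(j <- iota k m) f j) -> diverges f.
Proof.
move=> e0 f0 H; apply: (@diverges_from _ _ 0 f0) => c.
have step n : exists m, n%:R * e <= \sum_(j <- iota 0 m) f j.
  elim: n => [|n [m IH]]; first by exists 0%N; rewrite big_nil mul0r.
  have [m' hm'] := H m; exists (m + m')%N; rewrite iotaD big_cat/= add0n -natr1; lra.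
have [m hm] := step (Num.truncn (`|c| / e)).+1; exists m; apply: le_trans hm.
rewrite -ler_pdivrMr//; apply: le_trans (ltW (truncnS_gt _)).
by rewrite ler_pM2r ?invr_gt0// ler_norm.
Qed.

(** By monotonicity [n g (n j)] dominates the sum of [g] over the [n] indices from [n j] on. *)
Lemma diverges_blocks (R : realType) (g : nat -> R) (n : nat) : (0 < n)%N ->
  (forall j, 0 <= g j) -> (forall i j, (0 < i)%N -> (i <= j)%N -> g j <= g i) ->
  diverges g -> diverges (fun j => g (n * j)%N).
Proof.
move=> n0 g0 anti div; apply: (@diverges_from _ _ 1) => // c.
have nR : 0 < n%:R :> R by rewrite ltr0n.
have [m hm] := div n (n%:R * c); exists m.
rewrite -(ler_pM2l nR); apply: (le_trans hm).
apply: (@le_trans _ _ (\sum_(j <- iota n (n * m)) g j)).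
  have [k ->] : exists k, (n * m = m + k)%N by exists (n * m - m)%N; rewrite subnKC// leq_pmull.
  by rewrite iotaD big_cat/= lerDl; exact: sum_iota_ge0.
elim: m {hm} => [|m IH]; first by rewrite muln0 !big_nil mulr0.
rewrite mulnS addnC iotaD big_cat -[m.+1]addn1 iotaD big_cat/= mulrDr; apply: lerD => //.
rewrite big_seq1 add1n -mulnS.
apply: (@le_trans _ _ (\sum_(j <- iota (n * m.+1) n) g (n * m.+1)%N)).
  rewrite big_seq [leRHS]big_seq; apply: ler_sum => j; rewrite mem_iota => /andP[nj _].
  by apply: anti => //; rewrite muln_gt0 n0.
by rewrite big_const_seq count_predT size_iota iter_addr_0 [leRHS]mulr_natl.
Qed.

(** If [h j >= j] eventually, the maximum is [h j]. Otherwise [h k < k] for arbitrarily large [k];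
    by monotonicity the maximum is at most [k] at every positive index up to [k], so the terms from
    beyond [N <= k / 2] to [k] sum to at least [1 / 2]. *)
Lemma diverges_max (R : realType) (h : nat -> R) : (forall i j, (0 < i)%N -> (i <= j)%N -> h i <= h j) ->
  (forall j, (0 < j)%N -> 0 < h j) ->
  diverges (fun j => (h j)^-1) -> diverges (fun j => (Num.max (h j) j%:R)^-1).
Proof.
move=> hmono h0 div.
have f0 j : 0 <= (Num.max (h j) j%:R)^-1 by rewrite invr_ge0 le_max ler0n orbT.
have [inf|] := pselect (forall N : nat, exists2 k, (N <= k)%N & h k < k%:R).
  apply: (@diverges_step _ _ (1 / 2)) => // N.
  have [k Nk hk] := inf (2 * N).+1; have k0 : (0 < k)%N by apply: leq_trans Nk.
  have kR : 0 < k%:R :> R by rewrite ltr0n.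
  have N2 : (2 * N <= k)%N by apply: leq_trans Nk; rewrite leqnSn.
  have Nk' : (N <= k)%N by apply: leq_trans N2; rewrite leq_pmull.
  exists (k - N).+1; rewrite /= big_cons.
  apply: (@le_trans _ _ (\sum_(j <- iota N.+1 (k - N)) k%:R^-1)).
    rewrite big_const_seq count_predT size_iota iter_addr_0 -[leRHS]mulr_natl.
    rewrite ler_pdivlMr// natrB//; have : (2 * N)%:R <= k%:R :> R by rewrite ler_nat.
    by rewrite natrM; lra.
  rewrite -[leLHS]add0r; apply: lerD => //.
  rewrite big_seq [leRHS]big_seq; apply: ler_sum => j; rewrite mem_iota addSn subnKC// => /andP[Nj jk].
  have j0 : (0 < j)%N by apply: leq_trans Nj.
  rewrite lef_pV2 ?posrE//; last by rewrite lt_max h0.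
  rewrite ge_max; apply/andP; split; last by rewrite ler_nat.
  exact: le_trans (hmono _ _ j0 jk) (ltW hk).
move=> /existsNP[N /forall2NP hN].
apply: (@diverges_from _ _ N.+1) => // c; have [m hm] := div N.+1 c; exists m.
apply: (le_trans hm); rewrite big_seq [leRHS]big_seq; apply: ler_sum => j.
rewrite mem_iota => /andP[Nj _].
by have [/negP|/negP] := hN j; [rewrite (ltnW Nj)|rewrite -leNgt => hj; rewrite max_l].
Qed.

Lemma diverges_filter (R : realType) (f : nat -> R) (J : pred nat) : (forall j, 0 <= f j) ->
  (forall j, (0 < j)%N -> ~~ J j -> f j <= (j%:R ^+ 2)^-1) ->
  diverges f -> forall (k : nat) (c : R), exists m, c <= \sum_(j <- iota k m | J j) f j.
Proof.
move=> f0 small div k c; have [m hm] := div k.+1 (c + 2); exists m.+1.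
rewrite /= big_cons; have h : c <= \sum_(j <- iota k.+1 m | J j) f j.
  have : \sum_(j <- iota k.+1 m | ~~ J j) f j <= 2.
    apply: le_trans (sum_sqV_le R (k + m).+1).
    rewrite /index_iota subn1/= iotaD big_cat/= add1n.
    apply: (@le_trans _ _ (\sum_(j <- iota k.+1 m) (j%:R ^+ 2)^-1)); last first.
      by rewrite lerDr; apply: sumr_ge0 => j _; rewrite invr_ge0 sqr_ge0.
    rewrite big_mkcond big_seq [leRHS]big_seq; apply: ler_sum => j.
    rewrite mem_iota => /andP[kj _]; case: ifP => Jj; last by rewrite invr_ge0 sqr_ge0.
    by apply: small => //; exact: leq_trans kj.
  by move: hm; rewrite (bigID J)/=; lra.
by case: ifP => // _; apply: (le_trans h); rewrite lerDr.
Qed.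

Lemma diverges_of_nneseries (R : realType) (g : nat -> R) : (forall j, 0 <= g j) ->
  (\sum_(1 <= k <oo) (g k)%:E = +oo)%E -> diverges g.
Proof.
move=> g0 div; apply: (@diverges_from _ _ 1) => // c.
apply: contrapT => /forallNP H.
have : (\sum_(1 <= k <oo) (g k)%:E <= c%:E)%E.
  apply: lime_le; first by apply: is_cvg_nneseries => n _ _; rewrite lee_fin.
  near=> n; rewrite sumEFin lee_fin /index_iota ltW// ltNge; apply/negP; exact: H.
by rewrite div leye_eq.
Unshelve. all: by end_near. Qed.

Lemma ln_le_of_pow (R : realType) (N j : nat) : (0 < N)%N -> N%:R <= (2 : R) ^+ (5 * j) ->
  ln (N%:R : R) <= (5 * j)%:R.
Proof.
move=> N0 h; apply: (@le_trans _ _ (ln ((2 : R) ^+ (5 * j)))).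
  by rewrite ler_ln ?posrE ?ltr0n ?exprn_gt0.
rewrite lnXn// -[leLHS]mulr_natr ler_piMl//.
by have := @le_ln1Dx R 1 ltac:(lra); rewrite (_ : 1 + 1 = 2).
Qed.

Theorem theorem1 (R : realType) (psi : R -> R) :
  (forall x, 0 < x -> 0 < psi x) ->
  (forall x y, 0 < x -> x <= y -> psi x <= psi y) ->
  (\sum_(1 <= k <oo) ((psi k%:R)^-1)%:E = +oo)%E ->
  {ae (@lebesgue_measure R), forall a : R,
     upper_density R (sudler_small psi a) = 1}.
Proof.
move=> psi0 psimono div.
pose g (j : nat) : R := if j == 0%N then 0 else (psi j%:R)^-1.
have g0 j : 0 <= g j.
  by rewrite /g; case: eqP => // /eqP j0; rewrite invr_ge0 ltW// psi0// ltr0n lt0n.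
have gdiv : diverges g.
  apply: diverges_of_nneseries => //; rewrite -div; apply: congr_lim; apply/funext => n.
  by apply: eq_big_nat => i /andP[i0 _]; rewrite /g; case: eqP i0 => [->|].
have ganti i j : (0 < i)%N -> (i <= j)%N -> g j <= g i.
  move=> i0 ij; have j0 : (0 < j)%N by apply: leq_trans ij.
  rewrite /g !gtn_eqF// lef_pV2 ?posrE ?psi0 ?ltr0n//.
  by apply: psimono; rewrite ?ltr0n ?ler_nat.
(* The factor 5 anticipates [ln N <= 5 j], so that [h j] bounds [psi (ln N)]. *)
pose h (j : nat) : R := (g (5 * j))^-1.
have hE j : (0 < j)%N -> h j = psi (5 * j)%:R.
  by move=> j0; rewrite /h /g gtn_eqF ?muln_gt0// invrK.
have h0 j : (0 < j)%N -> 0 < h j.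
  by move=> j0; rewrite hE// psi0// ltr0n muln_gt0.
have hmono i j : (0 < i)%N -> (i <= j)%N -> h i <= h j.
  move=> i0 ij; have j0 : (0 < j)%N by apply: leq_trans ij.
  by rewrite !hE//; apply: psimono; rewrite ?ltr0n ?ler_nat ?muln_gt0// leq_mul2l ij orbT.
pose b (j : nat) : R := Num.max (h j) j%:R.
have bdiv : diverges (fun j => (b j)^-1).
  apply: diverges_max => //; have := diverges_blocks (isT : (0 < 5)%N) g0 ganti gdiv.
  by congr diverges; apply/funext => j; rewrite /h invrK.
have b0 j : 0 <= b j by rewrite /b le_max ler0n orbT.
have bj j : j%:R <= b j by rewrite /b le_max lexx orbT.
have bmono i j : (0 < i)%N -> (i <= j)%N -> b i <= b j.
  move=> i0 ij; rewrite /b ge_max !le_max hmono//=.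
  by rewrite ler_nat ij orbT.
pose J : pred nat := fun j => b j <= j%:R ^+ 2.
have Jdiv := diverges_filter (J := J) (fun j => (_ : 0 <= (b j)^-1)) _ bdiv.
pose eps (n : nat) : R := n.+1%:R^-1.
(* Chosen so that [T n * eps n ^ 2] is exactly [2 ^ 22]. *)
pose T (n : nat) : R := 2 ^+ 22 * n.+1%:R ^+ 2.
have T1 n : 1 <= T n.
  rewrite /T; apply: mulr_ege1; rewrite exprn_ege1//; first lra.
  by rewrite ler1n.
have aeall : {ae (@lebesgue_measure R), forall x : R, forall n j0 : nat,
    exists j, [/\ (j0 <= j)%N, J j & hits (fun j => T n * b j) j x]}.
  apply: ae_foralln => n; apply: ae_hits_io.
  - by move=> j _; apply: (le_trans (bj j)); rewrite ler_peMl.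
  - by move=> i j i0 ij; apply: ler_wpM2l; [have := T1 n; lra|exact: bmono].
  - move=> k c; have [m hm] : exists m, c * T n <= \sum_(j <- iota k m | J j) (b j)^-1.
      apply: Jdiv => j; first by rewrite invr_ge0.
      move=> j0; rewrite /J -ltNge => /ltW bb.
      by rewrite lef_pV2 ?posrE ?(lt_le_trans _ (bj j)) ?exprn_gt0 ?ltr0n.
    exists m; have Tn : 0 < T n by have := T1 n; lra.
    under eq_bigr do rewrite invfM.
    by rewrite -mulr_sumr mulrC ler_pdivlMr.
move: aeall; apply: filter_app; first exact: (ae_filter_ringOfSetsType (@lebesgue_measure R)).
apply: aeW => /= x io; apply: upper_density_eq1 => e M0 e0.
pose n := Num.truncn (2 / e).
have eps0 : 0 < eps n by rewrite invr_gt0 ltr0n.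
have eps1 : eps n <= 1 by rewrite invf_le1 ?ltr0n// ler1n.
have epse : 2 * eps n <= e.
  have : 2 / e < n.+1%:R by exact: truncnS_gt.
  by rewrite /eps ltr_pdivrMr// => h1; rewrite ler_pdivrMr ?ltr0n//; lra.
have Teps : 2 ^+ 22 <= T n * eps n ^+ 2.
  by rewrite /T /eps exprVn mulfK// expf_neq0// pnatr_eq0.
have [j1 j1P] := pow2_gt_sqr (2 * T n).
have [j2 j2P] := pow2_gt_sqr (2 ^+ 12 / eps n).
have [j [+ Jj [y gy xy]]] := io n (maxn (maxn 1 M0) (maxn j1 j2)).
rewrite !geq_max => /andP[/andP[jpos jM0] /andP[/j1P jT /j2P jE]].
have jR : 1 <= j%:R :> R by rewrite ler1n.
have [q [p [/andP[q1 q2] pq yE good]]] := gy.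
have q0 : (0 < q)%N by apply: leq_ltn_trans q1.
have qR : 0 < q%:R :> R by rewrite ltr0n.
set Q : R := (16 ^ j)%:R; have Q0 : 0 < Q by rewrite ltr0n expn_gt0.
have qQ : q%:R <= Q by rewrite ler_nat.
have Qq : Q <= 16 * q%:R.
  rewrite /Q -(prednK jpos) expnS natrM ler_pM2l// ler_nat ltnW//.
have T0 : 0 < T n by have := T1 n; lra.
have bj0 : 0 < b j by apply: lt_le_trans (bj j); lra.
set B := T n * b j; have B0 : 0 < B by rewrite mulr_gt0.
move: xy; rewrite /cell/= in_itv/= /len -/Q -/B; set L := (Q ^+ 2 * B)^-1 => /andP[x1 x2].
have QL : Q ^+ 2 * L * B = 1.
  by rewrite /L mulrAC mulfV// gt_eqF// mulr_gt0// exprn_gt0.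
have L0 : 0 < L by rewrite invr_gt0 mulr_gt0// exprn_gt0.
pose d := x - y; have dlo : L / 2 <= d by rewrite /d; lra.
have dhi : d <= L by rewrite /d; lra.
have d0 : 0 < d by lra.
have qd0 : 0 < q%:R ^+ 2 * d by rewrite mulr_gt0// exprn_gt0.
pose A := (q%:R ^+ 2 * d)^-1.
have A0 : 0 < A by rewrite invr_gt0.
have Ad : q%:R ^+ 2 * d * A = 1 by rewrite mulfV// gt_eqF.
have q2Q : q%:R ^+ 2 <= Q ^+ 2 by rewrite lerXn2r ?nnegrE// ltW.
have BA : B <= A.
  have qdQL : q%:R ^+ 2 * d <= Q ^+ 2 * L.
    by apply: ler_pM => //; exact: ltW.
  have := ler_wpM2r (ltW (mulr_gt0 A0 B0)) qdQL.
  have -> : q%:R ^+ 2 * d * (A * B) = q%:R ^+ 2 * d * A * B by ring.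
  have -> : Q ^+ 2 * L * (A * B) = Q ^+ 2 * L * B * A by ring.
  by rewrite Ad QL !mul1r.
have AT : T n * j%:R <= A.
  by apply: le_trans BA; rewrite /B ler_pM2l.
(* The factor 32 combines [d >= L / 2], from the outer half of the cell, with [Q <= 16 q]. It leaves
   [M <= 2 Q B]. *)
have qA : q%:R * A <= 32 * (Q * B).
  rewrite -(ler_pM2l (mulr_gt0 qR d0)).
  have -> : q%:R * d * (q%:R * A) = q%:R ^+ 2 * d * A by ring.
  rewrite Ad -[leLHS]QL.
  have h1 : Q * (L / 2) <= 16 * q%:R * d by apply: ler_pM; [exact: ltW|lra|exact: Qq|exact: dlo].
  have := ler_wpM2r (ltW (mulr_gt0 Q0 B0)) h1; lra.
pose M := Num.truncn (q%:R * A / 16).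
have M16 : M%:R <= q%:R * A / 16 < M%:R + 1.
  by rewrite natr1; apply: truncn_itv; rewrite divr_ge0// mulr_ge0// ltW.
pose K := Num.truncn (A / 8).
have K8 : K%:R <= A / 8 < K%:R + 1.
  by rewrite natr1; apply: truncn_itv; rewrite divr_ge0// ltW.
have jeps : (1 / 2) ^+ j * 2 ^+ 12 <= eps n.
  rewrite div1r exprVn mulrC ler_pdivrMr ?exprn_gt0//.
  have : 2 ^+ 12 / eps n <= 2 ^+ j by apply: le_trans jE; rewrite ler_peMr ?exprn_ege1// divr_ge0// ?exprn_ge0// ltW.
  by rewrite ler_pdivrMr// mulrC.
have q4 : (q <= 2 ^ (4 * j))%N by rewrite expnM.
have xE : x = p%:~R / q%:R + d by rewrite /d -yE subrKC.
have [cnt jM] := sudler_count_near_rational eps0 eps1 Teps jpos jeps q0 q4 pq good d0 Ad AT xE K8 M16.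
have MR : 0 < M%:R :> R by lra.
(* [Q] is [2 ^ (4 j)]; since [j] belongs to [J], the remaining [2 B] is at most [2 T j ^ 2], which
   is below [2 ^ j] for the large [j] selected. *)
have M2 : M%:R <= 2 ^+ (5 * j) :> R.
  have M1 : M%:R <= 2 * (Q * B) by case/andP: M16; lra.
  apply: (le_trans M1); rewrite (_ : 5 * j = 4 * j + j)%N; last by rewrite -mulSnr.
  have QE : Q = 2 ^+ (4 * j) by rewrite /Q natrX exprM; congr (_ ^+ _); rewrite -natrX.
  rewrite exprD -QE mulrCA; apply: ler_wpM2l; first exact: ltW.
  apply: le_trans jT; rewrite /B mulrA; apply: ler_wpM2l; first by rewrite mulr_ge0// ltW.
  exact: Jj.
exists M; split; first by rewrite (leq_trans jM0)// -(ler_nat R).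
rewrite /density_seq ler_pdivlMr//.
have /(congr1 (fun z : nat => z%:R : R)) := count_predC (sudler_small psi x) (iota 1 M).
rewrite size_iota natrD => cntE.
suff : (count (predC (sudler_small psi x)) (iota 1 M))%:R <= 2 * eps n * M%:R.
  have := ler_wpM2r (ltW MR) epse; move: cntE; lra.
apply: le_trans cnt; rewrite ler_nat -!size_filter; apply: uniq_leq_size.
  by rewrite filter_uniq// iota_uniq.
move=> N; rewrite !mem_filter mem_iota add1n ltnS => /andP[/= bad /andP[N1 NM]].
rewrite N1 NM !andbT; apply: contra bad => /andP[N2 small].
rewrite /sudler_small N2/=; case/orP: small => [->//|small]; apply/orP; right.
apply: (le_trans small); rewrite lerN2.
have NR : (N%:R : R) <= 2 ^+ (5 * j) by apply: le_trans M2; rewrite ler_nat.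
have lnN := ln_le_of_pow N1 NR.
apply: (@le_trans _ _ (b j)).
  apply: (@le_trans _ _ (psi (5 * j)%:R)); last by rewrite -hE// /b le_max lexx.
  (* [N > 1] makes [ln N] positive, where [psi] is monotone. *)
  by apply: psimono => //; rewrite ln_gt0// ltr1n.
have TE : 2 ^+ 10 <= T n * eps n.
  apply: (@le_trans _ _ (T n * eps n ^+ 2)); last by rewrite expr2 mulrA ler_piMr// mulr_ge0// ltW.
  by apply: le_trans Teps; lra.
have := ler_wpM2l (ltW eps0) BA; have := ler_wpM2r (ltW bj0) TE; rewrite /B; lra.
Qed.
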